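(* Let $A_{2+},B_{2+}\in H^\infty$, $B_{2+}\not\equiv0$, with $\inf_{z\in\mathbb D}\big(|A_{2+}(z)|+|B_{2+}(z)|\big)>0$. Then $$(H^2_+)_{A_{2+}/B_{2+}}=\ker H_{A_{2+}/B_{2+}}=B_{2+}H^2_+.$$ Analogously, if $A_{1-},B_{1-}\in\overline{H^\infty}$, $B_{1-}\not\equiv0$, with $\inf_{z\in\mathbb D}\big(|\overline{A_{1-}}(z)|+|\overline{B_{1-}}(z)|\big)>0$, then $$(H^2_-)_{A_{1-}/B_{1-}}=\ker\widetilde H_{A_{1-}/B_{1-}}=B_{1-}H^2_-.$$
   Context: $\mathbb T$ is the unit circle, $\mathbb D$ the unit disc, $L^2=L^2(\mathbb T)$. $H^2_+=H^2(\mathbb D)$ (as a subspace of $L^2$ via boundary values), $H^2_-=L^2\ominus H^2_+=\overline{H^2_0}$, with orthogonal projections $P^\pm$ of $L^2$ onto $H^2_\pm$. $H^\infty$ is the algebra of bounded analytic functions on $\mathbb D$ (identified with boundary functions), $\overline{H^\infty}$ the set of conjugates of its elements; for $h\in\overline{H^\infty}$, $\overline h$ is regarded as an analytic function on $\mathbb D$. For a space $\mathcal H$ of functions on $\mathbb T$ and a measurable function $X$ on $\mathbb T$, $\mathcal H_X=\{h\in\mathcal H:Xh\in\mathcal H\}$. For a measurable function $X$, $\ker H_X=\{\phi_+\in H^2_+:P^-X\phi_+=0\}$ and $\ker\widetilde H_X=\{\phi_-\in H^2_-:P^+X\phi_-=0\}$ are kernels of (possibly unbounded) Hankel operators, the conditions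 being understood as $X\phi_+\in H^2_+$ and $X\phi_-\in H^2_-$ respectively. *)

(* Defs.v *)
From HB Require Import structures.
From mathcomp Require Import all_boot all_order all_algebra.
From mathcomp Require Import all_classical all_reals all_analysis.
From mathcomp Require Export complex.

Set Implicit Arguments.
Unset Strict Implicit.
Unset Printing Implicit Defensive.

Import Order.TTheory GRing.Theory Num.Theory.
Import numFieldNormedType.Exports.

Local Open Scope classical_set_scope.
Local Open Scope ring_scope.
Local Open Scope complex_scope.

Section HardySpaces.
Variable R : realType.

Implicit Types (F G : R[i] -> R[i]) (X phi psi : R[i] -> R[i]).

Definition cabs (z : R[i]) : R := Normc.normc z.

Definition disc : set R[i] := [set z | cabs z < 1].

(* A function on the circle is given by a function on the plane, of which only
   the values at the points [circ t] matter. *)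
Definition circ (t : R) : R[i] := cos t +i* sin t.

Definition ae_circle (P : R[i] -> Prop) : Prop :=
  {ae lebesgue_measure, forall t : R, t \in `[0, 2 * pi] -> P (circ t)}.

Definition eq_circle phi psi : Prop := ae_circle (fun z => phi z = psi z).

(* Integral over the circle of |phi|^2 d t, not divided by 2 pi. *)
Definition sqint phi : \bar R :=
  \int[lebesgue_measure]_(t in `[0, 2 * pi]) ((cabs (phi (circ t))) ^+ 2)%:E.

(* Lebesgue's sigma-algebra is obtained from the Borel one by allowing a change
   on a null set; all the spaces below are thus stable under a.e. equality. *)
Definition L2_circle : set (R[i] -> R[i]) := [set phi |
  exists psi, [/\ measurable_fun `[0, 2 * pi] (fun t => complex.Re (psi (circ t))),
                  measurable_fun `[0, 2 * pi] (fun t => complex.Im (psi (circ t))),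
                  (sqint psi < +oo)%E &
                  eq_circle phi psi]].

(* [R[i]^o] is [R[i]] as a normed space over itself: complex
   differentiability. *)
Definition analytic_disc F : Prop :=
  forall z, disc z -> derivable (F : R[i]^o -> R[i]^o) z 1.

Definition Hardy2_disc : set (R[i] -> R[i]) := [set F | analytic_disc F /\
  exists M : R, forall r : R, 0 <= r < 1 ->
    (sqint (fun z => F (r%:C * z)%R) <= M%:E)%E].

Definition Hinf_disc : set (R[i] -> R[i]) := [set F | analytic_disc F /\
  exists M : R, forall z, disc z -> cabs (F z) <= M].

(* [phi] is the boundary function of [F]: radial limits almost everywhere. *)
Definition boundary_values F phi : Prop :=
  ae_circle (fun z =>
    (fun r : R => (F (r%:C * z)%R : R[i]^o)) @ 1^'- --> (phi z : R[i]^o)).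

Definition Hplus : set (R[i] -> R[i]) := [set phi | L2_circle phi /\
  exists2 F, Hardy2_disc F & boundary_values F phi].

(* The conjugates of the boundary functions of the elements of H^2 vanishing
   at 0; this is the orthogonal complement of [Hplus] in L^2. *)
Definition Hminus : set (R[i] -> R[i]) := [set phi | L2_circle phi /\
  exists F, [/\ Hardy2_disc F, F 0 = 0 &
                boundary_values F (fun z => (phi z)^*)]].

Definition mult_domain (H : set (R[i] -> R[i])) X : set (R[i] -> R[i]) :=
  [set h | H h /\ H (fun z => X z * h z)].

(* The condition P^- (X phi) = 0 for the possibly unbounded operator means
   X phi \in H^2_+. *)
Definition ker_Hankel X : set (R[i] -> R[i]) :=
  [set phi | Hplus phi /\ Hplus (fun z => X z * phi z)].

(* Likewise P^+ (X phi) = 0 means X phi \in H^2_-. *)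
Definition ker_coHankel X : set (R[i] -> R[i]) :=
  [set phi | Hminus phi /\ Hminus (fun z => X z * phi z)].

Definition mul_space X (H : set (R[i] -> R[i])) : set (R[i] -> R[i]) :=
  [set phi | exists2 f, H f & eq_circle phi (fun z => X z * f z)].

End HardySpaces.

(* Main.v *)
Require Import Defs.
From mathcomp Require Import all_boot all_order all_algebra.
From mathcomp Require Import all_classical all_reals all_analysis.
From mathcomp Require Import measurable_realfun.
From mathcomp Require Import ring lra.

(** The theorem rests on a division argument in the disc.  Let [h] and
    [g = (a / b) h] be boundary functions of [H] and [G] in the Hardy space.  The
    function [A H - B G] is in the Hardy space and its boundary values
    [a h - b g] vanish almost everywhere, so it is zero: [A H = B G].  As [A] and
    [B] have no common zero, [F = H / B = G / A] is analytic in the whole disc,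
    and from [|B| |F| = |H|], [|A| |F| = |G|] and [|A| + |B| >= dl] one gets
    [|F| <= (|H| + |G|) / dl].  Hence [F] is in the Hardy space, its boundary
    function is [h / b], and [h = b (h / b)] (lemma [coprime_division]).
    Conversely, if [phi = b f] then [(a / b) phi = a f] (lemma
    [multiplier_boundary]).  The second half of the theorem is the same argument
    for the conjugate functions; it remains only to see that [F 0 = 0] when
    [H 0 = G 0 = 0], and this holds because [A 0] or [B 0] is nonzero.

    Both directions use that the boundary values of a nonzero Hardy function are
    nonzero almost everywhere ([boundary_neq0]): for [B], so that [a / b]
    makes sense, and for [A H - B G].  To prove it, write [F z = z ^ k G z] with
    [G 0] nonzero ([zero_factor]) and use Jensen's inequality ([jensen])
      [2 ln |G 0| <= mean of ln (|G|^2 + eps) over the circle of radius r].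
    Since [x - ln (x + eps) >= 0] for [eps <= 1], the nonnegative functions
    [|G|^2 - ln (|G|^2 + eps)] on circles of radii tending to 1 have bounded
    integrals when [eps] tends to 0, and by Fatou's lemma their lower limit is
    finite almost everywhere; at a point where the radial limit of [F] is 0, that
    lower limit is infinite.

    Jensen's inequality follows from the mean value property of the product of
    the [n] rotations [w |-> G (w_j w)], [w_j] the [n]-th roots of unity: its
    value at 0 is [G 0 ^ n], while on the circle the [n]-th root of its modulus
    is the exponential of a Riemann sum of [ln |G|].  Letting [n] tend to infinity
    gives the mean of the logarithm.

    An analytic function is only assumed to be complex differentiable at each
    point, so the mean value property and Cauchy's formula ([cauchy_formula])
    start from Goursat's bisection ([additive_rect_small], [goursat_rect]).
    It is applied to the form [F (z) dz / (z - z1)] in the coordinates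
    [z = z1 + s (r e^(it) - z1)], in which it is regular as long as [s > 0]; the
    integral over [t] then does not depend on [s], and Cauchy's formula is the
    comparison of [s = 1] with [s] tending to 0. *)

Set Implicit Arguments.
Unset Strict Implicit.
Unset Printing Implicit Defensive.

Import Order.TTheory GRing.Theory Num.Theory.
Import numFieldNormedType.Exports.

Local Open Scope classical_set_scope.
Local Open Scope ring_scope.
Local Open Scope complex_scope.

(** * Moduli and real and imaginary parts *)

Section Modulus.
Variable R : realType.
Implicit Types (z w : R[i]) (r t : R).

Lemma cabsE z : `|z| = (cabs z)%:C.
Proof. by []. Qed.

Lemma cabs_ge0 z : 0 <= cabs z.
Proof. by have := normr_ge0 z; rewrite cabsE ler0c. Qed.

Lemma cabs0 : cabs (0 : R[i]) = 0.
Proof. exact: Normc.normc0. Qed.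

Lemma cabs_eq0 z : (cabs z == 0) = (z == 0).
Proof.
apply/eqP/eqP => [|->]; [exact: Normc.eq0_normc | exact: cabs0].
Qed.

Lemma cabs_gt0 z : (0 < cabs z) = (z != 0).
Proof. by rewrite lt0r cabs_ge0 andbT cabs_eq0. Qed.

Lemma cabs1 : cabs (1 : R[i]) = 1.
Proof. exact: Normc.normc1. Qed.

Lemma cabsM z w : cabs (z * w) = cabs z * cabs w.
Proof. exact: Normc.normcM. Qed.

Lemma cabsV z : cabs z^-1 = (cabs z)^-1.
Proof. exact: Normc.normcV. Qed.

Lemma cabsX z n : cabs (z ^+ n) = cabs z ^+ n.
Proof. by elim: n => [|n IH]; rewrite ?expr0 ?cabs1// !exprS cabsM IH. Qed.

Lemma cabsN z : cabs (- z) = cabs z.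
Proof. exact: normcN. Qed.

Lemma cabsD z w : cabs (z + w) <= cabs z + cabs w.
Proof. exact: le_normcD. Qed.

Lemma cabsB z w : cabs (z - w) <= cabs z + cabs w.
Proof. by rewrite -(cabsN w) cabsD. Qed.

Lemma cabs_dist z w : cabs (z - w) = cabs (w - z).
Proof. by rewrite -cabsN opprB. Qed.

Lemma lerB_cabs z w : cabs z - cabs w <= cabs (z - w).
Proof. by rewrite lerBlDr -[in leLHS](subrK w z) cabsD. Qed.

Lemma cabs_sqr z : cabs z ^+ 2 = complex.Re z ^+ 2 + complex.Im z ^+ 2.
Proof. by case: z => a b; rewrite sqr_sqrtr// addr_ge0// sqr_ge0. Qed.

Lemma normRe_cabs z : `|complex.Re z| <= cabs z.
Proof.
by rewrite -(@ler_pXn2r _ 2)// ?nnegrE ?cabs_ge0// cabs_sqr real_normK ?num_real// lerDl sqr_ge0.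
Qed.

Lemma normIm_cabs z : `|complex.Im z| <= cabs z.
Proof.
by rewrite -(@ler_pXn2r _ 2)// ?nnegrE ?cabs_ge0// cabs_sqr real_normK ?num_real// lerDr sqr_ge0.
Qed.

Lemma cabs_le_ReIm z : cabs z <= `|complex.Re z| + `|complex.Im z|.
Proof.
rewrite -(@ler_pXn2r _ 2)// ?nnegrE ?cabs_ge0 ?addr_ge0// cabs_sqr sqrrD.
rewrite !real_normK ?num_real// -addrA lerD2l lerDr mulrn_wge0// mulr_ge0//.
Qed.

Lemma cabsR r : cabs r%:C = `|r|.
Proof. by rewrite /cabs /= expr0n addr0 sqrtr_sqr. Qed.

Lemma cabs_conj z : cabs z^* = cabs z.
Proof. by case: z => a b; rewrite /cabs /= sqrrN. Qed.

Lemma cReD z w : complex.Re (z + w) = complex.Re z + complex.Re w.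
Proof. by case: z; case: w. Qed.
Lemma cImD z w : complex.Im (z + w) = complex.Im z + complex.Im w.
Proof. by case: z; case: w. Qed.
Lemma cReB z w : complex.Re (z - w) = complex.Re z - complex.Re w.
Proof. by case: z; case: w. Qed.
Lemma cImB z w : complex.Im (z - w) = complex.Im z - complex.Im w.
Proof. by case: z; case: w. Qed.
Lemma cReM z w :
  complex.Re (z * w) = complex.Re z * complex.Re w - complex.Im z * complex.Im w.
Proof. by case: z; case: w. Qed.
Lemma cImM z w :
  complex.Im (z * w) = complex.Re z * complex.Im w + complex.Im z * complex.Re w.
Proof. by case: z; case: w. Qed.

Lemma cabs_circ t : cabs (circ t) = 1.
Proof. by rewrite /cabs /= cos2Dsin2 sqrtr1. Qed.

Lemma circ_neq0 t : circ t != 0.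
Proof. by rewrite -cabs_eq0 cabs_circ oner_eq0. Qed.

Lemma circD s t : circ (s + t) = circ s * circ t.
Proof.
by rewrite /circ cosD sinD; congr Complex; rewrite [RHS]addrC.
Qed.

Lemma circ0 : circ (0 : R) = 1.
Proof. by rewrite /circ cos0 sin0. Qed.

Lemma circ2pi : circ (2 * pi : R) = 1.
Proof. by rewrite /circ mulr_natl cos2pi sin2pi. Qed.

Lemma cabs_rcirc r t : 0 <= r -> cabs (r%:C * circ t) = r.
Proof. by move=> r0; rewrite cabsM cabs_circ mulr1 cabsR ger0_norm. Qed.

End Modulus.

(** * Bisection of rectangles *)

Section Goursat.
Variable R : realType.

(** Goursat's argument.  If [|J|] exceeded [e] times the square of the
    half-perimeter on some rectangle, by additivity it would do so on one of its
    four quarters, hence on a sequence of rectangles shrinking to a point, against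
    the local bound there.  Halving both sides at once divides the square of the
    half-perimeter exactly by 4. *)
Lemma additive_rect_small (J : R -> R -> R -> R -> R) (a b c d : R) :
  a < b -> c < d ->
  (forall s0 s s1 t0 t1, a <= s0 -> s0 < s -> s < s1 -> s1 <= b ->
     c <= t0 -> t0 < t1 -> t1 <= d ->
     J s0 s1 t0 t1 = J s0 s t0 t1 + J s s1 t0 t1) ->
  (forall s0 s1 t0 t t1, a <= s0 -> s0 < s1 -> s1 <= b ->
     c <= t0 -> t0 < t -> t < t1 -> t1 <= d ->
     J s0 s1 t0 t1 = J s0 s1 t0 t + J s0 s1 t t1) ->
  (forall p q, a <= p <= b -> c <= q <= d -> forall e, 0 < e ->
     exists2 dl, 0 < dl & forall s0 s1 t0 t1,
       a <= s0 -> s0 <= p <= s1 -> s1 <= b ->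
       c <= t0 -> t0 <= q <= t1 -> t1 <= d ->
       s0 < s1 -> t0 < t1 -> s1 - s0 < dl -> t1 - t0 < dl ->
       `|J s0 s1 t0 t1| <= e * (s1 - s0 + (t1 - t0)) ^+ 2) ->
  J a b c d = 0.
Proof.
move=> ab cd Js Jt Jsmall.
set l := b - a + (d - c).
have l0 : 0 < l by rewrite /l; lra.
suff H : forall e, 0 < e -> `|J a b c d| <= e * l ^+ 2.
  apply/eqP; rewrite -normr_le0; apply/ler_addgt0Pr => e e0.
  rewrite add0r (le_trans (H (e / l ^+ 2) _))// ?divr_gt0 ?exprn_gt0//.
  by rewrite divfK// gt_eqF// exprn_gt0.
move=> e e0; rewrite leNgt; apply/negP => bad0.
pose good (Q : R * R * R * R) := let: (s0, s1, t0, t1) := Q in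
  [/\ a <= s0, s0 < s1, s1 <= b & [/\ c <= t0, t0 < t1 & t1 <= d]].
pose bad (Q : R * R * R * R) := let: (s0, s1, t0, t1) := Q in
  e * (s1 - s0 + (t1 - t0)) ^+ 2 < `|J s0 s1 t0 t1|.
pose half (Q Q' : R * R * R * R) := let: (s0, s1, t0, t1) := Q in
  let: (s0', s1', t0', t1') := Q' in
  [/\ s0 <= s0', s1' <= s1, s1' - s0' = (s1 - s0) / 2 &
   [/\ t0 <= t0', t1' <= t1 & t1' - t0' = (t1 - t0) / 2]].
have step Q : good Q /\ bad Q -> exists Q', (good Q' /\ bad Q') /\ half Q Q'.
  move: Q => [[[s0 s1] t0] t1] [[as0 s01 s1b [ct0 t01 t1d]] badQ].
  have [s sE] : exists s, s = (s0 + s1) / 2 by exists ((s0 + s1) / 2).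
  have [t tE] : exists t, t = (t0 + t1) / 2 by exists ((t0 + t1) / 2).
  have [s0s ss1 s0h s1h] : [/\ s0 < s, s < s1, s - s0 = (s1 - s0) / 2 & s1 - s = (s1 - s0) / 2].
    by clear -sE s01; split; lra.
  have [t0t tt1 t0h t1h] : [/\ t0 < t, t < t1, t - t0 = (t1 - t0) / 2 & t1 - t = (t1 - t0) / 2].
    by clear -tE t01; split; lra.
  have [as_ sb] : a <= s /\ s <= b by split; apply: ltW; [exact: le_lt_trans s0s|exact: lt_le_trans s1b].
  have [ct td] : c <= t /\ t <= d by split; apply: ltW; [exact: le_lt_trans t0t|exact: lt_le_trans t1d].
  have [ls0 ls1 lt0 lt1] : [/\ s0 <= s, s <= s1, t0 <= t & t <= t1] by split; exact: ltW.
  have JE : J s0 s1 t0 t1 = J s0 s t0 t + J s0 s t t1 + (J s s1 t0 t + J s s1 t t1).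
    by rewrite (Js s0 s s1)// (Jt s0 s t0 t t1)// (Jt s s1 t0 t t1).
  have [|/negP H1] := pselect (bad (s0, s, t0, t)).
    by move=> B; exists (s0, s, t0, t); repeat split.
  have [|/negP H2] := pselect (bad (s0, s, t, t1)).
    by move=> B; exists (s0, s, t, t1); repeat split.
  have [|/negP H3] := pselect (bad (s, s1, t0, t)).
    by move=> B; exists (s, s1, t0, t); repeat split.
  have [|/negP H4] := pselect (bad (s, s1, t, t1)).
    by move=> B; exists (s, s1, t, t1); repeat split.
  exfalso; move: badQ; rewrite /bad ltNge => /negP; apply.
  rewrite /bad -!leNgt in H1 H2 H3 H4.
  rewrite s0h t0h -mulrDl in H1; rewrite s0h t1h -mulrDl in H2.
  rewrite s1h t0h -mulrDl in H3; rewrite s1h t1h -mulrDl in H4.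
  set m := _ + (t1 - t0) in H1 H2 H3 H4 *.
  have -> : e * m ^+ 2 = e * (m / 2) ^+ 2 + e * (m / 2) ^+ 2 +
     (e * (m / 2) ^+ 2 + e * (m / 2) ^+ 2) by field.
  rewrite JE; apply: le_trans (ler_normD _ _) _; apply: lerD;
    apply: le_trans (ler_normD _ _) _; exact: lerD.
have /choice [f fP] : forall Q, exists Q', good Q /\ bad Q -> (good Q' /\ bad Q') /\ half Q Q'.
  move=> Q; have [/step [Q' HQ']|nQ] := pselect (good Q /\ bad Q); first by exists Q'.
  by exists Q => /nQ.
pose Q n := iter n f (a, b, c, d).
pose S0 n := (Q n).1.1.1; pose S1 n := (Q n).1.1.2.
pose T0 n := (Q n).1.2; pose T1 n := (Q n).2.
have QE n : Q n = (S0 n, S1 n, T0 n, T1 n).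
  by rewrite /S0 /S1 /T0 /T1; case: (Q n) => [[[? ?] ?] ?].
have QP n : good (Q n) /\ bad (Q n).
  elim: n => [|n IH]; first by repeat split=> //; exact: ltW.
  by have [] := fP _ IH.
have Qhalf n : half (Q n) (Q n.+1) by have [] := fP _ (QP n).
have mono n m : [/\ S0 n <= S0 (n + m)%N, S1 (n + m)%N <= S1 n, T0 n <= T0 (n + m)%N & T1 (n + m)%N <= T1 n].
  elim: m => [|m IH]; first by rewrite addn0 !lexx.
  rewrite addnS; have := Qhalf (n + m)%N; rewrite (QE (n + m)%N) (QE (n + m).+1).
  by move=> [h1 h2 _ [h3 h4 _]]; case: IH => [k1 k2 k3 k4]; clear -h1 h2 h3 h4 k1 k2 k3 k4; split; lra.
have lt0 n : S0 n < S1 n /\ T0 n < T1 n.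
  by have [+ _] := QP n; rewrite QE => -[? ? ? []].
have S01 n m : S0 n <= S1 m.
  have [+ _ _ _] := mono n m; have [_ + _ _] := mono m n; rewrite addnC => h1 h2.
  by apply: le_trans h2 (le_trans _ h1); apply: ltW; case: (lt0 (n + m)%N).
have T01 n m : T0 n <= T1 m.
  have [_ _ + _] := mono n m; have [_ _ _ +] := mono m n; rewrite addnC => h1 h2.
  by apply: le_trans h2 (le_trans _ h1); apply: ltW; case: (lt0 (n + m)%N).
have len n : S1 n - S0 n = (b - a) / 2 ^+ n /\ T1 n - T0 n = (d - c) / 2 ^+ n.
  elim: n => [|n [IH1 IH2]]; first by rewrite expr0 !divr1.
  have := Qhalf n; rewrite (QE n) (QE n.+1) => -[_ _ -> [_ _ ->]].
  by rewrite IH1 IH2 exprS invfM; split; ring.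
(* the common point of the rectangles *)
pose p := sup (range S0); pose q := sup (range T0).
have pS n : S0 n <= p <= S1 n.
  apply/andP; split.
    by apply: ub_le_sup; [exists b => _ [m _ <-]; exact: (S01 m 0%N)|exists n].
  by apply: ge_sup; [exists (S0 0%N), 0%N|move=> _ [m _ <-]; exact: S01].
have qT n : T0 n <= q <= T1 n.
  apply/andP; split.
    by apply: ub_le_sup; [exists d => _ [m _ <-]; exact: (T01 m 0%N)|exists n].
  by apply: ge_sup; [exists (T0 0%N), 0%N|move=> _ [m _ <-]; exact: T01].
have [dl dl0 H] := Jsmall p q (pS 0%N) (qT 0%N) e e0.
have [n ln] : exists n, l / 2 ^+ n < dl.
  exists (Num.truncn (l / dl)).+1; rewrite ltr_pdivrMr ?exprn_gt0//.
  rewrite mulrC -ltr_pdivrMr//; apply: lt_trans (truncnS_gt _) _.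
  by rewrite -natrX ltr_nat ltn_expl.
have [+ +] := QP n; rewrite QE => -[h1 h2 h3 [h4 h5 h6]].
have [l1 l2] := len n.
have i0 : 0 < (2 ^+ n : R)^-1 by rewrite invr_gt0 exprn_gt0.
rewrite /bad ltNge => /negP; apply; apply: H => //.
  by rewrite l1; apply: le_lt_trans ln; rewrite ler_pM2r// lerDl subr_ge0 ltW.
by rewrite l2; apply: le_lt_trans ln; rewrite ler_pM2r// lerDr subr_ge0 ltW.
Qed.

End Goursat.

(** * Integrals over segments and closed forms *)

Section Integral.
Variable R : realType.
Implicit Types (f g : R -> R) (a b e k : R).

Notation mu := (@lebesgue_measure R).

Definition rint a b f : R := \int[mu]_(x in `[a, b]) f x.

Notation ic a b f := {within `[a, b], continuous f}.

Lemma cont_integrable a b f : ic a b f -> mu.-integrable `[a, b] (EFin \o f).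
Proof. by move=> cf; apply: continuous_compact_integrable => //; exact: segment_compact. Qed.

Lemma cont_sub a b c d f : a <= c -> d <= b -> ic a b f -> ic c d f.
Proof.
move=> ac db; apply: continuous_subspaceW => x /=.
by rewrite !in_itv /= => /andP[? ?]; rewrite (le_trans ac)//= (le_trans _ db).
Qed.

Lemma cont_within a b f : continuous f -> ic a b f.
Proof. exact: continuous_subspaceT. Qed.

Lemma rintD a b f g : ic a b f -> ic a b g ->
  rint a b (fun x => f x + g x) = rint a b f + rint a b g.
Proof. by move=> cf cg; rewrite /rint RintegralD//; exact: cont_integrable. Qed.

Lemma rintB a b f g : ic a b f -> ic a b g ->
  rint a b (fun x => f x - g x) = rint a b f - rint a b g.
Proof. by move=> cf cg; rewrite /rint RintegralB//; exact: cont_integrable. Qed.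

Lemma rintZ a b k f : ic a b f -> rint a b (fun x => k * f x) = k * rint a b f.
Proof. by move=> cf; rewrite /rint RintegralZl//; exact: cont_integrable. Qed.

Lemma rint_cst a b k : a <= b -> rint a b (fun=> k) = k * (b - a).
Proof.
by move=> ab; rewrite /rint Rintegral_cst//= lebesgue_measure_itv/= lte_fin;
  case: ltgtP ab => // -> _; rewrite subrr.
Qed.

Lemma le_rint a b f g : ic a b f -> ic a b g ->
  (forall x, a <= x <= b -> f x <= g x) -> rint a b f <= rint a b g.
Proof.
by move=> cf cg fg; apply: (le_Rintegral _ (cont_integrable cf) (cont_integrable cg)).
Qed.

Lemma rint_approx a b f k e : a <= b -> ic a b f ->
  (forall x, a <= x <= b -> `|f x - k| <= e) ->
  `|rint a b f - k * (b - a)| <= e * (b - a).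
Proof.
move=> ab cf fk; rewrite ler_distl -mulrBl -mulrDl -!rint_cst//.
have ck (r : R) : ic a b (fun=> r) by apply: cont_within => x; exact: cst_continuous.
by apply/andP; split; apply: le_rint => // x /fk; rewrite ler_distl => /andP[].
Qed.

Lemma rint_split a c b f : a <= c -> c <= b -> ic a b f ->
  rint a b f = rint a c f + rint c b f.
Proof.
move=> ac cb cf; have /(Rintegral_itvB (x := c)) := cont_integrable cf.
rewrite !bnd_simp => /(_ ac cb) H.
have <- : \int[mu]_(x in `]c, b]) f x = rint c b f.
  apply: Rintegral_itv_obnd_cbnd; apply: (integrableS _ _ _ (cont_integrable cf)) => //.
  by apply: subset_itvr; rewrite bnd_simp.
by rewrite -H addrC subrK.
Qed.

Lemma eq_rint a b f g : (forall x, a <= x <= b -> f x = g x) -> rint a b f = rint a b g.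
Proof.
by move=> fg; apply: eq_Rintegral => x /set_mem/=; rewrite in_itv/=; exact: fg.
Qed.

(** The form [X ds + Y dt] is closed in a weak sense: the derivatives of [X] in
    [t] and of [Y] in [s] exist and have a common value [k] at each point, in a
    form uniform over the small rectangles around that point.  Its integral over
    the boundary of a rectangle is additive, and near each point it is small compared
    to the square of the half-perimeter because the contributions of [k] cancel; so it
    vanishes by bisection. *)
Lemma goursat_rect (X Y : R -> R -> R) a b c d : a < b -> c < d ->
  (forall t, c <= t <= d -> ic a b (X^~ t)) ->
  (forall s, a <= s <= b -> ic c d (Y s)) ->
  (forall p q, a <= p <= b -> c <= q <= d -> exists k, forall e, 0 < e ->
     exists2 dl, 0 < dl & forall s0 s1 t0 t1,
       a <= s0 -> s0 <= p <= s1 -> s1 <= b ->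
       c <= t0 -> t0 <= q <= t1 -> t1 <= d ->
       s1 - s0 < dl -> t1 - t0 < dl ->
       (forall s, s0 <= s <= s1 ->
         `|X s t1 - X s t0 - k * (t1 - t0)| <= e * (s1 - s0 + (t1 - t0))) /\
       (forall t, t0 <= t <= t1 ->
         `|Y s1 t - Y s0 t - k * (s1 - s0)| <= e * (s1 - s0 + (t1 - t0)))) ->
  rint a b (X^~ d) - rint a b (X^~ c) = rint c d (Y b) - rint c d (Y a).
Proof.
move=> ab cd cX cY loc.
pose J s0 s1 t0 t1 := rint s0 s1 (X^~ t1) - rint s0 s1 (X^~ t0)
  - (rint t0 t1 (Y s1) - rint t0 t1 (Y s0)).
suff : J a b c d = 0 by move/eqP; rewrite subr_eq0 => /eqP.
apply: additive_rect_small => //.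
- move=> s0 s s1 t0 t1 h1 h2 h3 h4 h5 h6 h7; rewrite /J.
  rewrite (@rint_split s0 s s1 (X^~ t1)) ?ltW//; last first.
    by apply: cont_sub (cX t1 _) => //; rewrite h7 andbT ltW// (le_lt_trans h5).
  rewrite (@rint_split s0 s s1 (X^~ t0)) ?ltW//; last first.
    by apply: cont_sub (cX t0 _) => //; rewrite h5/= ltW// (lt_le_trans _ h7).
  ring.
- move=> s0 s1 t0 t t1 h1 h2 h3 h4 h5 h6 h7; rewrite /J.
  rewrite (@rint_split t0 t t1 (Y s1)) ?ltW//; last first.
    by apply: cont_sub (cY s1 _) => //; rewrite h3 andbT ltW// (le_lt_trans h1).
  rewrite (@rint_split t0 t t1 (Y s0)) ?ltW//; last first.
    by apply: cont_sub (cY s0 _) => //; rewrite h1/= ltW// (lt_le_trans _ h3).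
  ring.
- move=> p q hp hq e e0; have [k loc1] := loc p q hp hq.
  have [dl dl0 H] := loc1 e e0; exists dl => // s0 s1 t0 t1 h1 h2 h3 h4 h5 h6 s01 t01 h7 h8.
  have [HX HY] := H s0 s1 t0 t1 h1 h2 h3 h4 h5 h6 h7 h8.
  have t0t : c <= t0 <= d by rewrite h4/=; apply/ltW/(lt_le_trans t01).
  have t1t : c <= t1 <= d by rewrite h6 andbT; apply/ltW/(le_lt_trans _ t01).
  have s0s : a <= s0 <= b by rewrite h1/=; apply/ltW/(lt_le_trans s01).
  have s1s : a <= s1 <= b by rewrite h3 andbT; apply/ltW/(le_lt_trans _ s01).
  have sub (F G : R -> R) u v : ic u v F -> ic u v G -> ic u v (fun x => F x - G x).
    by move=> cF cG x; apply: cvgB; [exact: cF|exact: cG].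
  have cX1 := cont_sub h1 h3 (cX _ t1t); have cX0 := cont_sub h1 h3 (cX _ t0t).
  have cY1 := cont_sub h4 h6 (cY _ s1s); have cY0 := cont_sub h4 h6 (cY _ s0s).
  have {}HX := rint_approx (ltW s01) (sub _ _ _ _ cX1 cX0) HX.
  have {}HY := rint_approx (ltW t01) (sub _ _ _ _ cY1 cY0) HY.
  rewrite rintB// in HX; rewrite rintB// in HY.
  have -> : J s0 s1 t0 t1 = (rint s0 s1 (X^~ t1) - rint s0 s1 (X^~ t0) - k * (t1 - t0) * (s1 - s0))
     - (rint t0 t1 (Y s1) - rint t0 t1 (Y s0) - k * (s1 - s0) * (t1 - t0)).
    by rewrite /J; ring.
  apply: le_trans (ler_normB _ _) _; apply: le_trans (lerD HX HY) _.
  by rewrite -mulrDr expr2 mulrA.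
Qed.

Lemma rint_EFin a b f : ic a b f ->
  (\int[mu]_(x in `[a, b]) (f x)%:E)%E = (rint a b f)%:E.
Proof.
by move=> cf; rewrite /rint /Rintegral fineK//; apply: integrable_fin_num => //; exact: cont_integrable.
Qed.

End Integral.

(** * Complex differentiability and paths *)

Section ComplexDerivative.
Variable R : realType.
Implicit Types (F G : R[i] -> R[i]) (z w d : R[i]).

Lemma ltc0_exists (e : R[i]) : 0 < e -> exists2 r : R, 0 < r & e = r%:C.
Proof.
by case: e => a b; rewrite ltcE /= => /andP[/eqP -> a0]; exists a.
Qed.

Lemma nbhsC_P z (P : set R[i]) :
  nbhs (z : R[i]^o) P <-> exists2 dl : R, 0 < dl & forall w, cabs (w - z) < dl -> P w.
Proof.
split=> [/nbhs_ballP[e /= /ltc0_exists[r r0 ->] H]|[dl dl0 H]].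
  exists r => // w wz; apply: H; rewrite -ball_normE /=.
  by rewrite cabsE cabs_dist ltcR.
apply/nbhs_ballP; exists dl%:C; first by rewrite /= ltcR.
by move=> w; rewrite -ball_normE /= cabsE cabs_dist ltcR => /H.
Qed.

Lemma cvgC_P (T : Type) (FF : set_system T) (FFF : Filter FF) (f : T -> R[i]) (l : R[i]) :
  ((fun x => f x : R[i]^o) @ FF --> (l : R[i]^o)) <->
  forall e : R, 0 < e -> \forall x \near FF, cabs (f x - l) <= e.
Proof.
split=> [/cvgrPdist_le H e e0|H].
  have := H e%:C; rewrite ltcR => /(_ e0); apply: filterS => x /=.
  by rewrite cabsE lecR cabs_dist.
apply/cvgrPdist_le => _ /ltc0_exists[e e0 ->].
by apply: filterS (H e e0) => x /=; rewrite cabsE lecR cabs_dist.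
Qed.

(** Differentiability with real radii and moduli; this is the shape in which the
    estimates of Goursat's lemma use it. *)
Definition cderiv F z d := forall e : R, 0 < e -> exists2 dl : R, 0 < dl &
  forall w, cabs (w - z) < dl -> cabs (F w - F z - d * (w - z)) <= e * cabs (w - z).

Lemma derivable_cderiv F z :
  derivable (F : R[i]^o -> R[i]^o) z 1 -> exists d, cderiv F z d.
Proof.
move=> /cvg_ex[d /cvgC_P H]; exists d => e /H /= /nbhsC_P[dl dl0 H1].
exists dl => // w wz; have [->|wz0] := eqVneq w z.
  by rewrite !subrr mulr0 subr0 cabs0 mulr0.
have := H1 (w - z); rewrite subr0 => /(_ wz).
rewrite subr_eq0 => /(_ wz0); rewrite /GRing.scale /= mulr1 subrK => H2.
have d0 : w - z != 0 by rewrite subr_eq0.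
rewrite -ler_pdivrMr ?cabs_gt0// -cabsV -cabsM mulrBl mulfK//.
by rewrite mulrC.
Qed.

Lemma cderiv_derivable F z d :
  cderiv F z d -> derivable (F : R[i]^o -> R[i]^o) z 1.
Proof.
move=> H; apply/cvg_ex; exists d; apply/cvgC_P => e /H[dl dl0 H1].
apply/nbhsC_P; exists dl => // h; rewrite subr0 => hd h0.
have := H1 (h + z); rewrite addrK => /(_ hd) H2.
rewrite /GRing.scale /= mulr1 -(ler_pM2r (x := cabs h)) ?cabs_gt0//.
by rewrite -cabsM mulrBl mulrAC mulVf// mul1r.
Qed.

Definition ccont F z := forall e : R, 0 < e -> exists2 dl : R, 0 < dl &
  forall w, cabs (w - z) < dl -> cabs (F w - F z) <= e.

Lemma continuous_ccont F z :
  {for z, continuous (F : R[i]^o -> R[i]^o)} <-> ccont F z.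
Proof.
have cvgP := @cvgC_P _ (nbhs (z : R[i]^o)) _ F (F z).
split=> [/cvgP H e /H /nbhsC_P//|H].
by apply/cvgP => e /H /nbhsC_P.
Qed.

Lemma cderiv_ccont F z d : cderiv F z d -> ccont F z.
Proof.
move=> /cderiv_derivable /derivable1_diffP /differentiable_continuous.
by move/continuous_ccont.
Qed.

End ComplexDerivative.

Section Circle.
Variable R : realType.
Implicit Types (s t : R).

Lemma cos_lip s t : `|cos s - cos t| <= `|s - t|.
Proof.
wlog st : s t / t <= s.
  by move=> H; have [/H//|/ltW/H] := leP t s; rewrite (distrC s) (distrC (cos s)).
have [x _ ->] := MVT_segment st (fun x _ => is_derive_cos x)
    (cont_within (@continuous_cos R)).
by rewrite normrM ler_piMl// normrN ler_norml sin_geN1 sin_le1.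
Qed.

Lemma sin_lip s t : `|sin s - sin t| <= `|s - t|.
Proof.
wlog st : s t / t <= s.
  by move=> H; have [/H//|/ltW/H] := leP t s; rewrite (distrC s) (distrC (sin s)).
have [x _ ->] := MVT_segment st (fun x _ => is_derive_sin x)
    (cont_within (@continuous_sin R)).
by rewrite normrM ler_piMl// ler_norml cos_geN1 cos_le1.
Qed.

Lemma circ_lip s t : cabs (circ s - circ t) <= 2 * `|s - t|.
Proof.
apply: le_trans (cabs_le_ReIm _) _; rewrite mulr_natl mulr2n.
by apply: lerD; [exact: cos_lip | exact: sin_lip].
Qed.

(** The tangent is taken at any intermediate [t0], not at an endpoint, because in
    the bisection the limit point lies anywhere in the small rectangle. *)
Lemma circ_deriv s t t0 tau : t <= s -> t <= t0 <= s -> s - t = tau ->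
  cabs (circ s - circ t - 'i%C * circ t0 * (s - t)%:C) <= 2 * tau ^+ 2.
Proof.
move=> st /andP[tt0 t0s] stE.
have near x : x \in `[t, s] -> `|t0 - x| <= tau.
  by rewrite in_itv/= => /andP[tx xs]; rewrite ler_norml; apply/andP; split; lra.
have tau0 : 0 <= tau by lra.
apply: le_trans (cabs_le_ReIm _) _; rewrite mulr_natl mulr2n; apply: lerD => /=.
  have [x /near xt ->] := MVT_segment st (fun x _ => is_derive_cos x)
    (cont_within (@continuous_cos R)).
  rewrite !(mul0r, mulr0, mul1r, subr0, sub0r, addr0, add0r, mulNr, opprK) stE.
  rewrite addrC -mulrBl normrM expr2 [`|tau|]ger0_norm//.
  by rewrite ler_wpM2r// (le_trans (sin_lip _ _)).
have [x /near xt ->] := MVT_segment st (fun x _ => is_derive_sin x)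
    (cont_within (@continuous_sin R)).
rewrite !(mul0r, mulr0, mul1r, subr0, sub0r, addr0, add0r, mulNr, opprK) stE.
rewrite -mulrBl normrM expr2 [`|tau|]ger0_norm//.
by rewrite ler_wpM2r// (le_trans (cos_lip _ _))// distrC.
Qed.

End Circle.

Section ComplexPaths.
Variable R : realType.
Implicit Types (f g : R -> R[i]) (t : R).

Definition pcont f t := forall e : R, 0 < e -> exists2 dl : R, 0 < dl &
  forall s, `|s - t| < dl -> cabs (f s - f t) <= e.

Lemma pcontP f t : pcont f t <-> {for t, continuous (f : R -> R[i]^o)}.
Proof.
have cvgP := @cvgC_P R _ (nbhs t) _ f (f t).
split=> [H|/cvgP H e /H /nbhs_ballP[dl /= dl0 Hd]].
  apply/cvgP => e /H[dl dl0 Hd]; apply/nbhs_ballP; exists dl => // s.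
  by rewrite /ball /= distrC => /Hd.
by exists dl => // s st; apply: Hd; rewrite /ball/= distrC.
Qed.

Lemma pcont_cst (c : R[i]) t : pcont (fun=> c) t.
Proof. by move=> e e0; exists 1 => // s _; rewrite subrr cabs0 ltW. Qed.

Lemma pcontD f g t : pcont f t -> pcont g t -> pcont (fun x => f x + g x) t.
Proof.
by move=> /pcontP cf /pcontP cg; apply/pcontP; exact: (@continuousD R[i] R[i]^o R f g t cf cg).
Qed.

Lemma pcontB f g t : pcont f t -> pcont g t -> pcont (fun x => f x - g x) t.
Proof.
by move=> /pcontP cf /pcontP cg; apply/pcontP; exact: (@continuousB R[i] R[i]^o R f g t cf cg).
Qed.

Lemma pcontM f g t : pcont f t -> pcont g t -> pcont (fun x => f x * g x) t.
Proof.
by move=> /pcontP cf /pcontP cg; apply/pcontP; exact: (@continuousM R[i] R f g t cf cg).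
Qed.

Lemma pcontV f t : f t != 0 -> pcont f t -> pcont (fun x => (f x)^-1) t.
Proof. by move=> f0 /pcontP cf; apply/pcontP; exact: (@continuousV R[i] R f t f0 cf). Qed.

Lemma pcontX f n t : pcont f t -> pcont (fun x => f x ^+ n) t.
Proof.
move=> cf; elim: n => [|n IH]; first exact: pcont_cst.
under eq_fun do rewrite exprS.
exact: pcontM.
Qed.

Lemma pcont_circ t : pcont (@circ R) t.
Proof.
move=> e e0; exists (e / 2); first by rewrite divr_gt0.
move=> s st; apply: le_trans (circ_lip _ _) _.
by rewrite mulrC -ler_pdivlMr// ltW.
Qed.

Lemma pcont_real t : pcont (fun x => x%:C) t.
Proof.
move=> e e0; exists e => // s st.
by rewrite -rmorphB cabsR ltW.
Qed.

Lemma pcont_comp (F : R[i] -> R[i]) f t :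
  ccont F (f t) -> pcont f t -> pcont (fun x => F (f x)) t.
Proof.
move=> /continuous_ccont cF /pcontP cf; apply/pcontP.
exact: (@continuous_comp R R[i]^o R[i]^o f F t cf cF).
Qed.

Lemma pcont_Re f t : pcont f t -> {for t, continuous (fun x => complex.Re (f x))}.
Proof.
move=> H; apply/cvgrPdist_le => e /H[dl dl0 Hd].
apply/nbhs_ballP; exists dl => // s; rewrite /ball /= distrC => /Hd.
by rewrite distrC -cReB; apply: le_trans; exact: normRe_cabs.
Qed.

Lemma pcont_Im f t : pcont f t -> {for t, continuous (fun x => complex.Im (f x))}.
Proof.
move=> H; apply/cvgrPdist_le => e /H[dl dl0 Hd].
apply/nbhs_ballP; exists dl => // s; rewrite /ball /= distrC => /Hd.
by rewrite distrC -cImB; apply: le_trans; exact: normIm_cabs.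
Qed.

Lemma pcont_cabs f t : pcont f t -> {for t, continuous (fun x => cabs (f x))}.
Proof.
move=> H; apply/cvgrPdist_le => e /H[dl dl0 Hd].
apply/nbhs_ballP; exists dl => // s; rewrite /ball /= distrC => /Hd.
apply: le_trans; rewrite ler_norml lerNl opprB cabs_dist lerB_cabs /=.
by rewrite cabs_dist lerB_cabs.
Qed.

(** The components are integrated separately; the bound [cabs_cint_le] then has an
    extra factor 2, to which its uses are insensitive. *)
Definition cint f : R[i] :=
  rint 0 (2 * pi) (fun t => complex.Re (f t)) +i*
  rint 0 (2 * pi) (fun t => complex.Im (f t)).

Lemma pi2_ge0 : 0 <= 2 * pi :> R.
Proof. by rewrite mulr_ge0// pi_ge0. Qed.

Definition pathc f := forall t, pcont f t.

Lemma pathc_Re f a b : pathc f -> {within `[a, b], continuous (fun x => complex.Re (f x))}.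
Proof. by move=> cf; apply: cont_within => x; exact: pcont_Re. Qed.

Lemma pathc_Im f a b : pathc f -> {within `[a, b], continuous (fun x => complex.Im (f x))}.
Proof. by move=> cf; apply: cont_within => x; exact: pcont_Im. Qed.

Lemma eq_cint f g : (forall t, f t = g t) -> cint f = cint g.
Proof. by move=> /funext ->. Qed.

Lemma cintD f g : pathc f -> pathc g -> cint (fun t => f t + g t) = cint f + cint g.
Proof.
move=> cf cg; rewrite /cint; congr Complex.
  rewrite -rintD; [|exact: pathc_Re|exact: pathc_Re].
  by apply: eq_rint => x _; rewrite cReD.
rewrite -rintD; [|exact: pathc_Im|exact: pathc_Im].
by apply: eq_rint => x _; rewrite cImD.
Qed.

Lemma cintZ c f : pathc f -> cint (fun t => c * f t) = c * cint f.
Proof.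
move=> cf; have rc (a : R) : {within `[0, 2 * pi], continuous (fun x => a * complex.Re (f x))}.
  by move=> x; apply: cvgM; [exact: cvg_cst|exact: pathc_Re].
have ric (a : R) : {within `[0, 2 * pi], continuous (fun x => a * complex.Im (f x))}.
  by move=> x; apply: cvgM; [exact: cvg_cst|exact: pathc_Im].
case: c => a b; rewrite /cint /GRing.mul /=; congr Complex.
  rewrite -!rintZ; [|exact: pathc_Im|exact: pathc_Re].
  rewrite -rintB//.
  by apply: eq_rint => x _; case: (f x).
rewrite -!rintZ; [|exact: pathc_Re|exact: pathc_Im].
rewrite -rintD//.
by apply: eq_rint => x _; case: (f x).
Qed.

Lemma cintB f g : pathc f -> pathc g -> cint (fun t => f t - g t) = cint f - cint g.
Proof.
move=> cf cg; rewrite (_ : - cint g = cint (fun t => -1 * g t)).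
  rewrite -cintD//; first by apply: eq_cint => t; rewrite mulN1r.
  by move=> t; apply: pcontM; [exact: pcont_cst|exact: cg].
by rewrite cintZ// mulN1r.
Qed.

Lemma cint_cst c : cint (fun=> c) = c * (2 * pi)%:C.
Proof.
by case: c => a b; rewrite /cint !rint_cst ?pi2_ge0//= subr0;
  rewrite /GRing.mul /= !mulr0 subr0 add0r.
Qed.

Lemma cabs_cint_le f e : pathc f -> (forall t, 0 <= t <= 2 * pi -> cabs (f t) <= e) ->
  cabs (cint f) <= 2 * e * (2 * pi).
Proof.
move=> cf fe; apply: le_trans (cabs_le_ReIm _) _.
rewrite (mulr_natl e) mulr2n mulrDl /cint /=.
have := rint_approx (k := 0) (e := e) pi2_ge0 (pathc_Re (a := 0) (b := 2 * pi) cf).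
have := rint_approx (k := 0) (e := e) pi2_ge0 (pathc_Im (a := 0) (b := 2 * pi) cf).
rewrite mul0r !subr0 => HI HR; apply: lerD.
  by apply: HR => t /fe; rewrite subr0; apply: le_trans; exact: normRe_cabs.
by apply: HI => t /fe; rewrite subr0; apply: le_trans; exact: normIm_cabs.
Qed.

Lemma cabs_cint_dist f c e : pathc f ->
  (forall t, 0 <= t <= 2 * pi -> cabs (f t - c) <= e) ->
  cabs (cint f - c * (2 * pi)%:C) <= 2 * e * (2 * pi).
Proof.
move=> cf fe; rewrite -cint_cst -cintB//; last by move=> t; exact: pcont_cst.
by apply: cabs_cint_le => // t; apply: pcontB => //; exact: pcont_cst.
Qed.

End ComplexPaths.

(** * Radial invariance of the integral of [F dz / (z - z1)] *)

Section Radial.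
Variable R : realType.
Variables (F : R[i] -> R[i]) (z1 : R[i]) (r : R).
Hypothesis z1r : cabs z1 < r.

Definition ray (t : R) : R[i] := r%:C * circ t - z1.

(** Logarithmic derivative of [ray]: on the curve [t |-> z1 + s ray t] the form
    [dz / (z - z1)] is [ray_logder t dt], whatever [s]. *)
Definition ray_logder (t : R) : R[i] := 'i%C * (r%:C * circ t) / ray t.
Definition ray_point (s t : R) : R[i] := z1 + s%:C * ray t.

Let r0 : 0 < r. Proof. by apply: le_lt_trans z1r; exact: cabs_ge0. Qed.

Lemma cabs_ray_ge t : r - cabs z1 <= cabs (ray t).
Proof. by apply: le_trans (lerB_cabs _ _); rewrite cabs_rcirc// ltW. Qed.

Lemma cabs_ray_le t : cabs (ray t) <= 2 * r.
Proof.
by apply: le_trans (cabsB _ _) _; rewrite cabs_rcirc ?(ltW r0)//; move: z1r; lra.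
Qed.

Lemma ray_neq0 t : ray t != 0.
Proof. by rewrite -cabs_gt0; apply: lt_le_trans (cabs_ray_ge t); rewrite subr_gt0. Qed.

Lemma cabs_i : cabs ('i%C : R[i]) = 1.
Proof. by rewrite /cabs /= expr0n add0r expr1n sqrtr1. Qed.

Lemma cabs_ray_logder_le t : cabs (ray_logder t) <= r / (r - cabs z1).
Proof.
rewrite /ray_logder cabsM cabsV cabsM cabs_i mul1r cabs_rcirc ?(ltW r0)//.
rewrite ler_pM2l// lef_pV2 ?posrE ?cabs_gt0 ?ray_neq0 ?subr_gt0//.
exact: cabs_ray_ge.
Qed.

Lemma ray_logderE t : ray_logder t * ray t = 'i%C * (r%:C * circ t).
Proof. by rewrite /ray_logder divfK// ray_neq0. Qed.

Lemma pathc_ray : pathc ray.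
Proof.
move=> t; apply: pcontB; last exact: pcont_cst.
by apply: pcontM; [exact: pcont_cst|exact: pcont_circ].
Qed.

Lemma pathc_ray_logder : pathc ray_logder.
Proof.
move=> t; apply: pcontM; last by apply: pcontV; [exact: ray_neq0|exact: pathc_ray].
apply: pcontM; first exact: pcont_cst.
by apply: pcontM; [exact: pcont_cst|exact: pcont_circ].
Qed.

Lemma ray_point_dist s t s' t' : 0 <= s' ->
  cabs (ray_point s t - ray_point s' t') <= 2 * r * (`|s - s'| + s' * `|t - t'|).
Proof.
move=> s'0.
have -> : ray_point s t - ray_point s' t' = (s - s')%:C * ray t + s'%:C * (r%:C * (circ t - circ t')).
  by rewrite /ray_point /ray rmorphB; ring.
apply: le_trans (cabsD _ _) _; rewrite [leRHS]mulrDr; apply: lerD.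
  by rewrite cabsM cabsR mulrC ler_wpM2r ?normr_ge0// cabs_ray_le.
rewrite !cabsM !cabsR (ger0_norm s'0) (ger0_norm (ltW r0)).
rewrite [leRHS](_ : _ = s' * (r * (2 * `|t - t'|))); last by ring.
by rewrite ler_wpM2l// ler_wpM2l ?(ltW r0)// circ_lip.
Qed.

(** In the coordinates [(s, t)] the form [F dz / (z - z1)] is
    [F / s ds + F ray_logder dt].  Near a point [P] where [F] has derivative [d],
    both cross derivatives equal [k = d ray'(t0)]: for the first because
    [d/dt (F / s) = F' ray'], for the second because [ray ray_logder = ray'].
    The constants below only make the two error terms at most half of the
    allowed error each. *)
Lemma dlog_form_local (a b s0 t0 : R) d : 0 < a -> a <= s0 <= b ->
  cderiv F (ray_point s0 t0) d ->
  exists k : R[i], forall e : R, 0 < e -> exists2 dl : R, 0 < dl & forall sA sB tA tB,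
    a <= sA -> sA <= s0 <= sB -> sB <= b -> tA <= t0 <= tB ->
    sB - sA < dl -> tB - tA < dl ->
    (forall s, sA <= s <= sB ->
      cabs (s%:C^-1 * F (ray_point s tB) - s%:C^-1 * F (ray_point s tA) - k * (tB - tA)%:C)
       <= e * (sB - sA + (tB - tA))) /\
    (forall t, tA <= t <= tB ->
      cabs (F (ray_point sB t) * ray_logder t - F (ray_point sA t) * ray_logder t - k * (sB - sA)%:C)
       <= e * (sB - sA + (tB - tA))).
Proof.
move=> a0 /andP[as0 s0b] dF.
exists (d * ('i%C * (r%:C * circ t0))) => e e0.
have s00 : 0 < s0 by exact: lt_le_trans as0.
set L := 2 * r * (1 + s0).
have L0 : 0 < L by rewrite /L ?mulr_gt0 ?addr_gt0 //.
set km := r / (r - cabs z1).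
have km0 : 0 < km by rewrite /km divr_gt0 ?subr_gt0 //.
set N := a^-1 + km.
have N0 : 0 < N by rewrite /N addr_gt0 ?invr_gt0 //.
set eta := e / (4 * L * N).
have eta0 : 0 < eta by apply: (divr_gt0 e0 (mulr_gt0 (mulr_gt0 _ L0) N0)).
have [dF0 dF00 HF] := dF eta eta0.
set m := 4 * (1 + cabs d) * r.
have m0 : 0 < m by rewrite /m ?mulr_gt0 ?ltr_pwDl ?cabs_ge0 //.
exists (Num.min (dF0 / (2 * L)) (e / (2 * m))).
  by rewrite lt_min (divr_gt0 dF00 (mulr_gt0 _ L0))// (divr_gt0 e0 (mulr_gt0 _ m0)).
move=> sA sB tA tB aA /andP[sA0 s0B] Bb /andP[tA0 t0B].
rewrite !lt_min => /andP[sd1 sd2] /andP[td1 td2].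
set D := sB - sA + (tB - tA).
have D0 : 0 <= D by rewrite /D; lra.
have close s t : sA <= s <= sB -> tA <= t <= tB ->
    cabs (ray_point s t - ray_point s0 t0) <= L * D.
  move=> /andP[h1 h2] /andP[h3 h4]; apply: le_trans (ray_point_dist _ _ _ (ltW s00)) _.
  rewrite /L -[leRHS]mulrA ler_wpM2l ?mulr_ge0// ?(ltW r0)//.
  have d1 : `|s - s0| <= D by rewrite ler_norml /D; apply/andP; split; lra.
  have d2 : `|t - t0| <= D by rewrite ler_norml /D; apply/andP; split; lra.
  by rewrite mulrDl mul1r lerD// ler_wpM2l// ltW.
have LD : L * D < dF0.
  rewrite mulrC -ltr_pdivlMr//.
  have -> : dF0 / L = dF0 / (2 * L) + dF0 / (2 * L) by field; rewrite gt_eqF.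
  by rewrite /D ltrD.
have rem s t : sA <= s <= sB -> tA <= t <= tB ->
    cabs (F (ray_point s t) - F (ray_point s0 t0) - d * (ray_point s t - ray_point s0 t0)) <= eta * (L * D).
  move=> hs ht; have c := close _ _ hs ht.
  apply: le_trans (HF _ (le_lt_trans c LD)) _.
  by rewrite ler_wpM2l// ltW.
have rem2 s t s' t' : sA <= s <= sB -> tA <= t <= tB -> sA <= s' <= sB -> tA <= t' <= tB ->
    cabs (F (ray_point s t) - F (ray_point s' t') - d * (ray_point s t - ray_point s' t')) <= 2 * eta * L * D.
  move=> h1 h2 h3 h4.
  rewrite (_ : F (ray_point s t) - _ - _ =
     (F (ray_point s t) - F (ray_point s0 t0) - d * (ray_point s t - ray_point s0 t0))
     - (F (ray_point s' t') - F (ray_point s0 t0) - d * (ray_point s' t' - ray_point s0 t0))); last by ring.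
  apply: le_trans (cabsB _ _) _.
  have := rem _ _ h1 h2; have := rem _ _ h3 h4; lra.
have etaE : 2 * eta * L * N = e / 2.
  by rewrite /eta; field; rewrite ?gt_eqF.
have mE x : 0 <= x <= e / (2 * m) -> 4 * cabs d * r * x <= e / 2.
  move=> /andP[x0 xe].
  have -> : e / 2 = m * (e / (2 * m)) by field; rewrite gt_eqF.
  apply: le_trans (ler_wpM2l (ltW m0) xe); rewrite ler_wpM2r//.
  by rewrite /m ler_wpM2r ?(ltW r0)// ler_wpM2l// lerDr.
split=> [s hs|t ht].
- have sp : 0 < s by move: hs => /andP[+ _]; apply: lt_le_trans; exact: lt_le_trans aA.
  have sn0 : s%:C != 0 by rewrite fmorph_eq0 gt_eqF.
  have tBB : tA <= tB <= tB by rewrite lexx andbT (le_trans tA0).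
  have tAA : tA <= tA <= tB by rewrite lexx (le_trans tA0).
  rewrite (_ : _ - _ = s%:C^-1 * (F (ray_point s tB) - F (ray_point s tA) - d * (ray_point s tB - ray_point s tA))
    + d * (r%:C * (circ tB - circ tA - 'i%C * circ t0 * (tB - tA)%:C))); last first.
    by rewrite /ray_point /ray; field.
  apply: le_trans (cabsD _ _) _.
  have H1 := rem2 _ _ _ _ hs tBB hs tAA.
  have tAB : tA <= tB by lra.
  have H2 := @circ_deriv R tB tA t0 (tB - tA) tAB (introT andP (conj tA0 t0B)) erefl.
  rewrite [leRHS](_ : _ = e / 2 * D + e / 2 * D); last by lra.
  apply: lerD.
    rewrite cabsM cabsV cabsR ger0_norm ?(ltW sp)//.
    apply: (@le_trans _ _ (a^-1 * (2 * eta * L * D))).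
      apply: ler_pM => //; rewrite ?invr_ge0 ?cabs_ge0 ?(ltW sp)//.
      rewrite lef_pV2 ?posrE//; move: hs => /andP[+ _]; exact: le_trans.
    rewrite -etaE (_ : _ * N * D = N * (2 * eta * L * D)); last by ring.
    apply: ler_wpM2r; first by rewrite mulr_ge0// ltW// mulr_gt0// mulr_gt0.
    by rewrite /N lerDl ltW.
  rewrite !cabsM cabsR (ger0_norm (ltW r0)).
  apply: (@le_trans _ _ (cabs d * (r * (2 * (tB - tA) ^+ 2)))).
    by rewrite !ler_wpM2l ?cabs_ge0// ltW.
  have tau : 0 <= tB - tA <= e / (2 * m) by rewrite (ltW td2) andbT; lra.
  apply: (@le_trans _ _ (4 * cabs d * r * (tB - tA) * (tB - tA))).
    rewrite expr2 -subr_ge0 (_ : _ - _ = 2 * (cabs d * (r * ((tB - tA) * (tB - tA))))); last by ring.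
    by rewrite !mulr_ge0 ?cabs_ge0 ?(ltW r0)//; case/andP: tau.
  apply: ler_pM; rewrite ?mulr_ge0 ?cabs_ge0 ?(ltW r0)//; try by case/andP: tau.
    exact: mE.
  by rewrite /D; lra.
- have sBB : sA <= sB <= sB by rewrite lexx andbT (le_trans sA0).
  have sAA : sA <= sA <= sB by rewrite lexx (le_trans sA0).
  rewrite (_ : _ - _ = ray_logder t * (F (ray_point sB t) - F (ray_point sA t) - d * (ray_point sB t - ray_point sA t))
    + d * ((sB - sA)%:C * ('i%C * (r%:C * (circ t - circ t0))))); last first.
    transitivity (ray_logder t * (F (ray_point sB t) - F (ray_point sA t)) - d * (sB - sA)%:C * (ray_logder t * ray t) +
      d * (sB - sA)%:C * ('i%C * (r%:C * (circ t - circ t0)))); last first.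
      by rewrite /ray_point rmorphB; ring.
    by rewrite ray_logderE; ring.
  apply: le_trans (cabsD _ _) _.
  have H1 := rem2 _ _ _ _ sBB ht sAA ht.
  have tn : `|t - t0| <= tB - tA.
    by move: ht => /andP[? ?]; rewrite ler_norml; apply/andP; split; lra.
  have H2 := circ_lip t t0.
  rewrite [leRHS](_ : _ = e / 2 * D + e / 2 * D); last by lra.
  apply: lerD.
    rewrite cabsM.
    apply: (@le_trans _ _ (km * (2 * eta * L * D))).
      by apply: ler_pM; rewrite ?cabs_ge0// cabs_ray_logder_le.
    rewrite -etaE (_ : _ * N * D = N * (2 * eta * L * D)); last by ring.
    apply: ler_wpM2r; first by rewrite mulr_ge0// ltW// mulr_gt0// mulr_gt0.
    by rewrite /N lerDr invr_ge0 ltW.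
  rewrite !cabsM !cabsR (ger0_norm (ltW r0)) cabs_i mul1r ger0_norm; last by lra.
  apply: (@le_trans _ _ (cabs d * ((sB - sA) * (r * (2 * (tB - tA)))))).
    rewrite ler_wpM2l ?cabs_ge0// ler_wpM2l ?subr_ge0 ?(le_trans sA0)// ler_wpM2l ?(ltW r0)//.
    by apply: le_trans H2 _; rewrite ler_wpM2l.
  have tau : 0 <= tB - tA <= e / (2 * m) by rewrite (ltW td2) andbT; lra.
  apply: (@le_trans _ _ (4 * cabs d * r * (tB - tA) * (sB - sA))).
    rewrite -subr_ge0 (_ : _ - _ = 2 * (cabs d * (r * ((tB - tA) * (sB - sA))))); last by ring.
    rewrite !mulr_ge0 ?cabs_ge0 ?(ltW r0) ?subr_ge0 ?(le_trans sA0)//; case/andP: tau => h _.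
    by rewrite -subr_ge0.
  apply: ler_pM; rewrite ?mulr_ge0 ?cabs_ge0 ?(ltW r0) ?subr_ge0 ?(le_trans sA0)//.
  + by case/andP: tau => h _; rewrite -subr_ge0.
  + exact: mE.
  + by rewrite /D; lra.
Qed.

(** Goursat's lemma for the real and imaginary parts of that form; the two edges
    [t = 0] and [t = 2 pi] coincide and cancel. *)
Lemma cint_ray_point_invariant (a b : R) : 0 < a -> a < b ->
  (forall s t, a <= s <= b -> exists d, cderiv F (ray_point s t) d) ->
  cint (fun t => F (ray_point b t) * ray_logder t) = cint (fun t => F (ray_point a t) * ray_logder t).
Proof.
move=> a0 ab dF.
have cFt s : a <= s <= b -> pathc (fun t => F (ray_point s t)).
  move=> hs t; apply: (@pcont_comp R F (ray_point s)).
    by have [d /cderiv_ccont] := dF s t hs.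
  apply: pcontD; first exact: pcont_cst.
  by apply: pcontM; [exact: pcont_cst|exact: pathc_ray].
have cFs t s : a <= s <= b -> pcont (fun s => s%:C^-1 * F (ray_point s t)) s.
  move=> hs; apply: pcontM.
    apply: pcontV; last exact: pcont_real.
    by rewrite fmorph_eq0 gt_eqF//; case/andP: hs => + _; exact: lt_le_trans.
  apply: (@pcont_comp R F (fun s => ray_point s t)).
    by have [d /cderiv_ccont] := dF s t hs.
  apply: pcontD; first exact: pcont_cst.
  by apply: pcontM; [exact: pcont_real|exact: pcont_cst].
have cY s : a <= s <= b -> pathc (fun t => F (ray_point s t) * ray_logder t).
  by move=> hs t; apply: pcontM; [exact: cFt|exact: pathc_ray_logder].
have pi0 : 0 < 2 * pi :> R by rewrite mulr_gt0// pi_gt0.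
have per s : ray_point s (2 * pi) = ray_point s 0 by rewrite /ray_point /ray circ2pi circ0.
have loc p q : a <= p <= b -> 0 <= q <= 2 * pi -> _ := fun hp _ =>
  let: ex_intro d Hd := dF p q hp in dlog_form_local a0 hp Hd.
rewrite /cint; congr Complex; apply/eqP; rewrite -subr_eq0; apply/eqP.
- have <- := @goursat_rect R (fun s t => complex.Re (s%:C^-1 * F (ray_point s t)))
    (fun s t => complex.Re (F (ray_point s t) * ray_logder t)) a b 0 (2 * pi) ab pi0.
  + by apply/eqP; rewrite subr_eq0; apply/eqP/eq_rint => s _; rewrite per.
  + move=> t _; apply: continuous_in_subspaceT => s /set_mem /=.
    by rewrite in_itv/= => hs; apply: pcont_Re; exact: cFs.
  + by move=> s hs; apply: pathc_Re; exact: cY.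
  + move=> p q hp hq; have [k Hk] := loc p q hp hq; exists (complex.Re k) => e /Hk[dl dl0 H].
    exists dl => // s0 s1 t0 t1 h1 h2 h3 _ h5 _ h7 h8.
    have [H1 H2] := H s0 s1 t0 t1 h1 h2 h3 h5 h7 h8.
    split=> [s /H1|t /H2]; apply: le_trans; apply: le_trans (normRe_cabs _);
      by rewrite !cReB [complex.Re (k * _)]cReM /= mulr0 subr0.
- have <- := @goursat_rect R (fun s t => complex.Im (s%:C^-1 * F (ray_point s t)))
    (fun s t => complex.Im (F (ray_point s t) * ray_logder t)) a b 0 (2 * pi) ab pi0.
  + by apply/eqP; rewrite subr_eq0; apply/eqP/eq_rint => s _; rewrite per.
  + move=> t _; apply: continuous_in_subspaceT => s /set_mem /=.
    by rewrite in_itv/= => hs; apply: pcont_Im; exact: cFs.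
  + by move=> s hs; apply: pathc_Im; exact: cY.
  + move=> p q hp hq; have [k Hk] := loc p q hp hq; exists (complex.Im k) => e /Hk[dl dl0 H].
    exists dl => // s0 s1 t0 t1 h1 h2 h3 _ h5 _ h7 h8.
    have [H1 H2] := H s0 s1 t0 t1 h1 h2 h3 h5 h7 h8.
    split=> [s /H1|t /H2]; apply: le_trans; apply: le_trans (normIm_cabs _);
      by rewrite !cImB [complex.Im (k * _)]cImM /= mulr0 add0r.
Qed.

End Radial.

(** * Mean values and Cauchy's formula *)

Section MeanValue.
Variable R : realType.
Implicit Types (F G : R[i] -> R[i]) (z w : R[i]) (r a b : R).

Lemma halve_scale (e x k : R) : 0 < x -> 0 < k -> e = 2 * (e / (2 * x * k) * k) * x.
Proof. by move=> x0 k0; field; rewrite !gt_eqF. Qed.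

Lemma pathc_on_circle G r : (forall w, cabs w = r -> ccont G w) -> 0 <= r ->
  pathc (fun t => G (r%:C * circ t)).
Proof.
move=> cG r0 t; apply: (@pcont_comp R G (fun t => r%:C * circ t)).
  by apply: cG; rewrite cabs_rcirc.
by apply: pcontM; [exact: pcont_cst|exact: pcont_circ].
Qed.

Lemma pathc_bounded (f : R -> R[i]) : pathc f ->
  exists2 M : R, 0 <= M & forall t, 0 <= t <= 2 * pi -> cabs (f t) <= M.
Proof.
move=> cf; have cn : {within `[0, 2 * pi], continuous (fun t => cabs (f t))}.
  by apply: cont_within => t; apply: pcont_cabs.
have [c _ Hc] := EVT_max (@pi2_ge0 R) cn.
by exists (cabs (f c)); rewrite ?cabs_ge0// => t t02; apply: Hc; rewrite in_itv.
Qed.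

(** With centre 0 and the unit circle, [ray_logder] is the constant ['i]. *)
Lemma cint_annulus G lo hi a b : 0 <= lo ->
  (forall w, lo < cabs w < hi -> exists d, cderiv G w d) ->
  lo < a -> a < b -> b < hi ->
  cint (fun t => G (b%:C * circ t)) = cint (fun t => G (a%:C * circ t)).
Proof.
move=> lo0 dG loa ab bhi; have a0 : 0 < a by exact: le_lt_trans loa.
have hE s t : ray_point 0 1 s t = s%:C * circ t :> R[i].
  by rewrite /ray_point /ray rmorph1; ring.
have kE t : ray_logder 0 1 t = 'i%C :> R[i].
  by rewrite /ray_logder /ray subr0 mulfK// mulf_neq0 ?circ_neq0// rmorph1 oner_neq0.
have c01 : cabs (0 : R[i]) < 1 by rewrite cabs0.
have H := @cint_ray_point_invariant R G 0 1 c01 a b a0 ab.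
have i0 : ('i%C : R[i]) != 0 by rewrite -cabs_gt0 cabs_i.
have pG s : a <= s <= b -> pathc (fun t => G (s%:C * circ t)).
  move=> /andP[as_ sb]; apply: pathc_on_circle; last by rewrite ltW// (lt_le_trans a0).
  move=> w ws; have [|d /cderiv_ccont//] := dG w.
  by rewrite ws (lt_le_trans loa)// (le_lt_trans sb).
apply: (mulfI i0); rewrite -!cintZ; [|by apply: pG; rewrite lexx ltW|by apply: pG; rewrite lexx ltW].
transitivity (cint (fun t => G (ray_point 0 1 b t) * ray_logder 0 1 t)).
  by apply: eq_cint => t; rewrite hE kE mulrC.
rewrite H; first by apply: eq_cint => t; rewrite hE kE mulrC.
move=> s t /andP[as_ sb]; apply: dG; rewrite hE cabs_rcirc.
  by rewrite (lt_le_trans loa)// (le_lt_trans sb).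
by rewrite ltW// (lt_le_trans a0).
Qed.

(** The mean does not depend on the radius, and over small circles it is close to
    [G 0] by continuity. *)
Lemma cint_center G hi b : (forall w, 0 < cabs w < hi -> exists d, cderiv G w d) ->
  ccont G 0 -> 0 < b -> b < hi ->
  cint (fun t => G (b%:C * circ t)) = G 0 * (2 * pi)%:C.
Proof.
move=> dG cG b0 bhi; apply/eqP; rewrite -subr_eq0 -cabs_eq0 eq_le cabs_ge0 andbT.
apply/ler_addgt0Pr => e e0; rewrite add0r.
have pi0 : 0 < 2 * pi :> R by rewrite mulr_gt0// pi_gt0.
have e10 : 0 < e / (2 * (2 * pi)) by rewrite divr_gt0// mulr_gt0.
have [dl dl0 H] := cG _ e10.
set a := Num.min (dl / 2) (b / 2).
have a0 : 0 < a by rewrite lt_min !divr_gt0.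
have ab : a < b by rewrite /a gt_min; apply/orP; right; rewrite ltr_pdivrMr// ltr_pMr// ltr1n.
have adl : a < dl by rewrite /a gt_min; apply/orP; left; rewrite ltr_pdivrMr// ltr_pMr// ltr1n.
rewrite (cint_annulus (lexx 0) dG a0 ab bhi).
rewrite [leRHS](halve_scale e pi0 ltr01) !mulr1.
apply: cabs_cint_dist.
  apply: pathc_on_circle; last exact: ltW.
  move=> w wa; have [|d /cderiv_ccont//] := dG w.
  by rewrite wa a0 (lt_trans ab).
by move=> t _; apply: H; rewrite subr0 cabs_rcirc// ltW.
Qed.

Lemma cderiv_winding z w : w != z -> exists d, cderiv (fun w => w / (w - z)) w d.
Proof.
move=> wz; apply: derivable_cderiv.
apply: (@derivableM R[i] R[i]^o id (fun w => (w - z)^-1)); first exact: derivable_id.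
apply: (@derivableV R[i] R[i]^o (fun w => w - z)); first by rewrite subr_eq0.
by apply: (@derivableB R[i] R[i]^o R[i]^o); [exact: derivable_id|exact: derivable_cst].
Qed.

(** The integrand is analytic outside the disc of radius [cabs z], so the circle can
    be enlarged until the integrand is uniformly close to 1. *)
Lemma cint_winding z r : cabs z < r ->
  cint (fun t => r%:C * circ t / (r%:C * circ t - z)) = (2 * pi)%:C.
Proof.
move=> zr; have r0 : 0 < r by apply: le_lt_trans zr; exact: cabs_ge0.
rewrite -[RHS]mul1r.
apply/eqP; rewrite -subr_eq0 -cabs_eq0 eq_le cabs_ge0 andbT.
apply/ler_addgt0Pr => e e0; rewrite add0r.
have pi0 : 0 < 2 * pi :> R by rewrite mulr_gt0// pi_gt0.
set e1 := e / (2 * (2 * pi)).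
have e10 : 0 < e1 by rewrite divr_gt0// mulr_gt0.
set b := r + cabs z / e1.
have -> : cint (fun t => r%:C * circ t / (r%:C * circ t - z)) =
  cint (fun t => (b + 1)%:C * circ t / ((b + 1)%:C * circ t - z)).
  apply/esym; apply: (@cint_annulus (fun w => w / (w - z)) (cabs z) (b + 2)) => //.
  - exact: cabs_ge0.
  - move=> w /andP[zw _]; apply: cderiv_winding.
    by apply/eqP => wz; rewrite wz ltxx in zw.
  - by rewrite /b -addrA ltrDl ltr_wpDl// divr_ge0 ?cabs_ge0// ltW.
  - by rewrite ltrD2l ltr1n.
rewrite [leRHS](halve_scale e pi0 ltr01) !mulr1 -/e1.
have b1 : cabs z < b + 1.
  by apply: (lt_le_trans zr); rewrite /b -addrA lerDl addr_ge0// divr_ge0 ?cabs_ge0// ltW.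
have bp : 0 <= b + 1 by apply: ltW; apply: le_lt_trans b1; exact: cabs_ge0.
apply: cabs_cint_dist.
  apply: (@pathc_on_circle (fun w => w / (w - z))) => // w wb.
  have [|d /cderiv_ccont//] := @cderiv_winding z w.
  by apply/eqP => wz; rewrite -wb wz ltxx in b1.
move=> t _; set w := _ * circ t.
have wb : cabs w = b + 1 by rewrite cabs_rcirc.
have wz : w - z != 0 by rewrite subr_eq0; apply/eqP => wz; rewrite -wb wz ltxx in b1.
have -> : w / (w - z) - 1 = z / (w - z) by field.
rewrite cabsM cabsV ler_pdivrMr ?cabs_gt0//.
apply: (@le_trans _ _ (e1 * (b + 1 - cabs z))); last first.
  by rewrite ler_wpM2l ?(ltW e10)// -wb lerB_cabs.
have -> : cabs z = e1 * (cabs z / e1) by field; rewrite ?gt_eqF ?pi_gt0 //.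
rewrite -[X in X * (_ / _)]/e1 ler_wpM2l ?(ltW e10)//.
rewrite [X in _ - X](_ : _ = cabs z); last by field; rewrite ?gt_eqF ?pi_gt0 //.
by rewrite /b; move: zr; lra.
Qed.

(** Contract the circle to the point [z] along the segments to [z]: the integral does
    not change, and [F] becomes uniformly close to [F z]. *)
Lemma cauchy_formula F hi z r : (forall w, cabs w < hi -> exists d, cderiv F w d) ->
  cabs z < r -> r < hi ->
  cint (fun t => F (r%:C * circ t) * (r%:C * circ t / (r%:C * circ t - z))) =
  F z * (2 * pi)%:C.
Proof.
move=> dF zr rhi; have r0 : 0 < r by apply: le_lt_trans zr; exact: cabs_ge0.
have i0 : ('i%C : R[i]) != 0 by rewrite -cabs_gt0 cabs_i.
have z0 := cabs_ge0 z.
have Hin s t : 0 <= s <= 1 -> cabs (ray_point z r s t) < hi.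
  move=> /andP[s0 s1]; apply: le_lt_trans rhi.
  have -> : ray_point z r s t = (1 - s)%:C * z + s%:C * (r%:C * circ t).
    by rewrite /ray_point /ray rmorphB rmorph1; ring.
  apply: le_trans (cabsD _ _) _; rewrite !cabsM !cabsR cabs_circ mulr1.
  rewrite (ger0_norm s0) (ger0_norm (ltW r0)) ger0_norm ?subr_ge0//.
  rewrite [leRHS](_ : r = (1 - s) * r + s * r); last by ring.
  by rewrite lerD2r ler_wpM2l ?subr_ge0// ltW.
have ph s : 0 <= s <= 1 -> pathc (fun t => F (ray_point z r s t)).
  move=> s01 t; apply: (@pcont_comp R F (ray_point z r s)).
    by have [d /cderiv_ccont] := dF _ (Hin s t s01).
  apply: pcontD; first exact: pcont_cst.
  by apply: pcontM; [exact: pcont_cst|exact: pathc_ray].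
have pk := pathc_ray_logder zr.
have h1 t : ray_point z r 1 t = r%:C * circ t by rewrite /ray_point /ray rmorph1; ring.
have kE t : ray_logder z r t = 'i%C * (r%:C * circ t / (r%:C * circ t - z)).
  by rewrite /ray_logder /ray -!mulrA.
have pw : pathc (fun t => r%:C * circ t / (r%:C * circ t - z)).
  move=> t; have := pcontM (@pcont_cst R 'i%C^-1 t) (pk t).
  by under eq_fun do rewrite kE mulKf//.
have p1 : pathc (fun t => F (r%:C * circ t)).
  by have := ph 1; rewrite ler01 lexx => /(_ isT); under eq_fun do rewrite h1.
suff H : cint (fun t => F (ray_point z r 1 t) * ray_logder z r t) = cint (fun t => F z * ray_logder z r t).
  apply: (mulfI i0); rewrite -(cint_winding zr).
  rewrite mulrCA -!cintZ//.
  - transitivity (cint (fun t => F (ray_point z r 1 t) * ray_logder z r t)).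
      by apply: eq_cint => t; rewrite h1 kE; ring.
    by rewrite H; apply: eq_cint => t; rewrite kE.
  - by move=> t; apply: pcontM; [exact: pcont_cst|exact: pw].
  - by move=> t; apply: pcontM; [exact: p1|exact: pw].
apply/eqP; rewrite -subr_eq0 -cabs_eq0 eq_le cabs_ge0 andbT.
apply/ler_addgt0Pr => e e0; rewrite add0r.
have pi0 : 0 < 2 * pi :> R by rewrite mulr_gt0// pi_gt0.
set km := r / (r - cabs z).
have km0 : 0 < km by rewrite /km divr_gt0 ?subr_gt0 //.
set e1 := e / (2 * (2 * pi) * km).
have e10 : 0 < e1 by apply: (divr_gt0 e0 (mulr_gt0 (mulr_gt0 _ pi0) km0)).
have [d0 dFz] := dF z (lt_trans zr rhi).
have [dl dl0 Hdl] := cderiv_ccont dFz e10.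
set s := Num.min (1 / 2) (dl / (4 * r)).
have s0 : 0 < s by rewrite lt_min !divr_gt0 ?mulr_gt0 //.
have s1 : s < 1 by rewrite /s gt_min; apply/orP; left; lra.
have sdl : s * (2 * r) < dl.
  rewrite -ltr_pdivlMr ?mulr_gt0// /s gt_min; apply/orP; right.
  by rewrite ltr_pM2l// ltf_pV2 ?posrE ?mulr_gt0// ltr_pM2r// ltr_nat.
rewrite (cint_ray_point_invariant zr s0 s1); last first.
  move=> s' t /andP[ss' s'1]; apply: dF; apply: Hin; rewrite s'1 andbT.
  exact: le_trans (ltW s0) ss'.
have s01 : 0 <= s <= 1 by rewrite !ltW.
rewrite -cintB; last 2 first.
- by move=> t; apply: pcontM; [exact: ph|exact: pk].
- by move=> t; apply: pcontM; [exact: pcont_cst|exact: pk].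
rewrite [leRHS](halve_scale e pi0 km0) -/e1.
apply: cabs_cint_le.
  move=> t; apply: pcontB; apply: pcontM; try exact: pk; [exact: ph|exact: pcont_cst].
move=> t _; rewrite -mulrBl cabsM; apply: ler_pM; rewrite ?cabs_ge0//.
  apply: Hdl; apply: le_lt_trans sdl.
  rewrite /ray_point addrC addKr cabsM cabsR ger0_norm ?(ltW s0)//.
  by rewrite ler_wpM2l ?(ltW s0)// cabs_ray_le.
exact: cabs_ray_logder_le.
Qed.

End MeanValue.

(** * Order of vanishing at the origin *)

Section ZeroOrder.
Variable R : realType.
Implicit Types (F G : R[i] -> R[i]) (z w : R[i]) (r : R) (k : nat).

Lemma analytic_cderiv F : analytic_disc F ->
  forall w, cabs w < 1 -> exists d, cderiv F w d.
Proof. by move=> aF w w1; apply: derivable_cderiv; exact: aF. Qed.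

(** Up to the factor [2 pi], the [k]-th Taylor coefficient of [F] at 0. *)
Definition circle_moment F r k := cint (fun t => F (r%:C * circ t) * (r%:C * circ t) ^- k).

(** Up to the factor [2 pi], the Taylor series of [F] at [z] without its first [k]
    terms, divided by [z ^ k]. *)
Definition taylor_tail F r k z := cint (fun t => F (r%:C * circ t) * (r%:C * circ t) ^- k *
  (r%:C * circ t / (r%:C * circ t - z))).

Section FixedRadius.
Variables (F : R[i] -> R[i]) (r : R).
Hypothesis aF : analytic_disc F.
Hypothesis r01 : 0 < r < 1.

Let r0 : 0 < r. Proof. by case/andP: r01. Qed.
Let rc_neq0 t : r%:C * circ t != 0.
Proof. by rewrite mulf_neq0 ?circ_neq0// fmorph_eq0 gt_eqF. Qed.
Let prc : pathc (fun t => r%:C * circ t).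
Proof. by move=> t; apply: pcontM; [exact: pcont_cst|exact: pcont_circ]. Qed.

Let pFk k : pathc (fun t => F (r%:C * circ t) * (r%:C * circ t) ^- k).
Proof.
move=> t; apply: pcontM.
  apply: (@pathc_on_circle R F r) => [w wr|]; last exact: ltW.
  have [|d /cderiv_ccont//] := analytic_cderiv aF (w := w).
  by rewrite wr; case/andP: r01.
apply: pcontV; first by rewrite expf_neq0.
by apply: pcontX; exact: prc.
Qed.

Let rcz_neq0 z t : cabs z < r -> r%:C * circ t - z != 0.
Proof.
move=> zr; rewrite subr_eq0; apply/eqP => h.
by move: zr; rewrite -h cabs_rcirc ?ltxx// ltW.
Qed.

Let pw z : cabs z < r -> pathc (fun t => r%:C * circ t / (r%:C * circ t - z)).
Proof.
move=> zr t; apply: pcontM; first exact: prc.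
apply: pcontV; first exact: rcz_neq0.
by apply: pcontB; [exact: prc|exact: pcont_cst].
Qed.

Lemma taylor_tail0 z : cabs z < r -> taylor_tail F r 0 z = F z * (2 * pi)%:C.
Proof.
move=> zr; rewrite -(cauchy_formula (analytic_cderiv aF) zr); last by case/andP: r01.
by apply: eq_cint => t; rewrite expr0 invr1 mulr1.
Qed.

(** From [w / (w - z) = 1 + (z / w) (w / (w - z))]. *)
Lemma taylor_tailS k z : cabs z < r -> taylor_tail F r k z = circle_moment F r k + z * taylor_tail F r k.+1 z.
Proof.
move=> zr; rewrite /taylor_tail /circle_moment -cintZ; last first.
  by move=> t; apply: pcontM; [exact: pFk|exact: pw].
rewrite -cintD; [|exact: pFk|]; last first.
  by move=> t; apply: pcontM; [exact: pcont_cst|apply: pcontM; [exact: pFk|exact: pw]].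
apply: eq_cint => t; have := rcz_neq0 t zr; have := rc_neq0 t.
rewrite exprS invfM; move: (r%:C * circ t) => zeta z0 z1.
move: (F zeta) (zeta ^- k) => u v; field.
by rewrite z0 z1.
Qed.

Lemma taylor_tail_bound : exists2 M : R, 0 <= M & forall k z, cabs z < r ->
  cabs (taylor_tail F r k z) <= M / r ^+ k / (r - cabs z).
Proof.
have [M0 M00 HM] := pathc_bounded (pFk 0).
have pi0 := @pi2_ge0 R.
exists (2 * (M0 * r) * (2 * pi)); first by rewrite !mulr_ge0 ?(ltW r0) ?pi_ge0.
move=> k z zr; rewrite (_ : _ / (r - cabs z) =
   2 * (M0 * (r ^+ k)^-1 * (r / (r - cabs z))) * (2 * pi)); last by ring.
apply: cabs_cint_le; first by move=> t; apply: pcontM; [exact: pFk|exact: pw].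
move=> t t02; rewrite cabsM; apply: ler_pM; rewrite ?cabs_ge0//.
  rewrite cabsM; apply: ler_pM; rewrite ?cabs_ge0//.
    by have := HM t t02; rewrite expr0 invr1 mulr1.
  by rewrite cabsV cabsX cabs_rcirc ?(ltW r0).
rewrite cabsM cabsV cabs_rcirc ?(ltW r0)// ler_pM2l//.
rewrite lef_pV2 ?posrE ?subr_gt0 ?cabs_gt0 ?rcz_neq0//.
by apply: le_trans (lerB_cabs _ _); rewrite cabs_rcirc ?(ltW r0).
Qed.

Lemma taylor_tail_moments0 k z : cabs z < r -> (forall m, (m < k)%N -> circle_moment F r m = 0) ->
  F z * (2 * pi)%:C = z ^+ k * taylor_tail F r k z.
Proof.
move=> zr; elim: k => [|k IH] Hm; first by rewrite expr0 mul1r taylor_tail0.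
rewrite IH; last by move=> m mk; apply: Hm; exact: ltnW.
by rewrite (taylor_tailS k zr) Hm// add0r mulrA -exprSr.
Qed.

(** If all the coefficients vanish then [F z] is [O ((cabs z / r) ^ k)] for every
    [k]. *)
Lemma circle_moment_neq0 z : cabs z < r -> F z != 0 -> exists k, circle_moment F r k != 0.
Proof.
move=> zr Fz; apply: contrapT => /forallNP H.
have H0 m : circle_moment F r m = 0 by apply/eqP; apply/negPn/negP; exact: H.
have [M M0 HM] := taylor_tail_bound.
have rz : 0 < r - cabs z by rewrite subr_gt0.
have q1 : `|cabs z / r| < 1.
  by rewrite ger0_norm ?divr_ge0 ?cabs_ge0 ?(ltW r0)// ltr_pdivrMr// mul1r.
move/eqP: Fz; apply; apply/eqP.
have pi0 : (2 * pi)%:C != 0 :> R[i] by rewrite fmorph_eq0 gt_eqF// mulr_gt0 ?pi_gt0.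
rewrite -(mulIr_eq0 _ (mulIf pi0)) -cabs_eq0 eq_le cabs_ge0 andbT.
apply/ler_addgt0Pr => e e0; rewrite add0r.
have e1 : 0 < e / ((M + 1) / (r - cabs z)) by rewrite !divr_gt0// ltr_wpDl.
have /cvgrPdist_lt /(_ _ e1) [N _ /(_ N (leqnn N))] := cvg_expr q1.
rewrite sub0r normrN ger0_norm ?exprn_ge0 ?divr_ge0 ?cabs_ge0 ?(ltW r0)// => qN.
rewrite (taylor_tail_moments0 (k := N) zr)// cabsM cabsX.
apply: (@le_trans _ _ ((cabs z / r) ^+ N * (M / (r - cabs z)))).
  rewrite expr_div_n -!mulrA ler_wpM2l ?exprn_ge0 ?cabs_ge0//.
  by apply: le_trans (HM N z zr) _; rewrite [leRHS]mulrCA mulrA.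
apply: (@le_trans _ _ ((cabs z / r) ^+ N * ((M + 1) / (r - cabs z)))).
  rewrite ler_wpM2l ?exprn_ge0 ?divr_ge0 ?cabs_ge0 ?(ltW r0)//.
  by rewrite ler_pM2r ?invr_gt0// lerDl.
by rewrite -ler_pdivlMr ?ltW// divr_gt0// ltr_wpDl.
Qed.

End FixedRadius.

(** [k] is the index of the first nonzero Taylor coefficient and [G 0] is that
    coefficient.  Continuity of [G] at 0 is what [cint_center] asks for. *)
Lemma zero_factor F z0 : analytic_disc F -> disc z0 -> F z0 != 0 ->
  exists k G, [/\ G 0 != 0, ccont G 0,
    forall w, 0 < cabs w < 1 -> exists d, cderiv G w d &
    forall w, w != 0 -> F w = w ^+ k * G w].
Proof.
move=> aF z01 Fz0.
have [r z0r r01] : exists2 r, cabs z0 < r & 0 < r < 1.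
  have z0_ge := cabs_ge0 z0; move: z01; rewrite /disc /= => z01.
  by exists ((1 + cabs z0) / 2); last (apply/andP; split); lra.
have r0 : 0 < r by case/andP: r01.
have exk := circle_moment_neq0 aF r01 z0r Fz0.
pose k := ex_minn exk.
have [mk mkmin] : circle_moment F r k != 0 /\ forall m, (m < k)%N -> circle_moment F r m = 0.
  rewrite /k; case: ex_minnP => k' h1 h2; split=> // m mk.
  by apply/eqP; apply: contraTT mk => /h2; rewrite -leqNgt.
have pi0 : (2 * pi)%:C != 0 :> R[i] by rewrite fmorph_eq0 gt_eqF// mulr_gt0 ?pi_gt0.
pose c := circle_moment F r k / (2 * pi)%:C.
pose G w := if w == 0 then c else F w / w ^+ k.
exists k, G; split.
- by rewrite /G eqxx mulf_neq0// invr_neq0.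
- have [M M0 HM] := taylor_tail_bound aF r01.
  have Gc w : cabs w < r / 2 -> cabs (G w - G 0) <=
      (M / r ^+ k.+1 / (r / 2)) / cabs ((2 * pi)%:C : R[i]) * cabs w.
    move=> wr; have wr' : cabs w < r by rewrite (lt_trans wr)// ltr_pdivrMr// ltr_pMr// ltr1n.
    rewrite {2}/G eqxx /G; case: eqVneq => [->|w0].
      by rewrite subrr cabs0 mulr0.
    have E := taylor_tail_moments0 aF r01 wr' mkmin.
    have {}E : F w / w ^+ k = taylor_tail F r k w / (2 * pi)%:C.
      apply: (mulIf pi0); rewrite divfK// mulrAC E.
      by rewrite mulrC mulKf// expf_neq0.
    rewrite E taylor_tailS// /c -mulrBl addrAC subrr add0r !cabsM cabsV mulrC [leRHS]mulrC mulrA.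
    rewrite (mulrC _ (cabs w)) -mulrA ler_wpM2l ?cabs_ge0//.
    rewrite mulrC ler_wpM2r ?invr_ge0 ?cabs_ge0//.
    apply: le_trans (HM _ _ wr') _; rewrite ler_wpM2l//.
      by rewrite divr_ge0// exprn_ge0 ?ltW.
    rewrite lef_pV2 ?posrE ?subr_gt0 ?(divr_gt0 r0)//; move: wr; lra.
  set C := (M / r ^+ k.+1 / (r / 2)) / cabs ((2 * pi)%:C : R[i]) in Gc.
  have C0 : 0 <= C by rewrite /C ?divr_ge0 ?cabs_ge0 ?exprn_ge0 ?(ltW r0).
  move=> e e0; exists (Num.min (r / 2) (e / (C + 1))).
    by rewrite lt_min !divr_gt0// ltr_wpDl.
  move=> w; rewrite subr0 lt_min => /andP[w1 w2].
  apply: le_trans (Gc _ w1) _; apply: (@le_trans _ _ ((C + 1) * cabs w)).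
    by rewrite ler_wpM2r ?cabs_ge0// lerDl.
  by rewrite mulrC -ler_pdivlMr ?ltW// ltr_wpDl.
- move=> w /andP[w0 w1]; rewrite cabs_gt0 in w0.
  have [d1 /cderiv_derivable dF] := analytic_cderiv aF w1.
  have [d Hd] : exists d, cderiv (fun w => F w * (w ^+ k)^-1) w d.
    apply: derivable_cderiv.
    apply: (@derivableM R[i] R[i]^o F (fun w => (w ^+ k)^-1)); first exact: dF.
    apply: (@derivableV R[i] R[i]^o (fun w => w ^+ k)); first by rewrite expf_neq0.
    exact: exprn_derivable.
  exists d => e /Hd[dl dl0 H]; exists (Num.min dl (cabs w)).
    by rewrite lt_min dl0 cabs_gt0.
  move=> v; rewrite lt_min => /andP[v1 v2].
  have v0 : v != 0.
    by apply: contraTneq v2 => ->; rewrite sub0r cabsN ltxx.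
  by rewrite /G (negbTE w0) (negbTE v0); exact: H.
- by move=> w w0; rewrite /G (negbTE w0) mulrC divfK// expf_neq0.
Qed.

End ZeroOrder.

(** * Riemann sums *)

Section RiemannSums.
Variable R : realType.
Implicit Types (f : R -> R) (a b e h eta : R).

Lemma segment_unif_cont f a b e : continuous f -> 0 < e ->
  exists2 dl : R, 0 < dl & forall x y, a <= x <= b -> `|y - x| < dl -> `|f y - f x| <= e.
Proof.
move=> cf e0.
have /compact_near_coveringP H := @segment_compact R a b.
have : \forall n \near \oo, forall x, `[a, b]%classic x ->
    forall y, `|y - x| < n.+1%:R^-1 -> `|f y - f x| <= e.
  apply: (H _ \oo (fun n x => forall y, `|y - x| < n.+1%:R^-1 -> `|f y - f x| <= e)).
  move=> x _; have e20 : 0 < e / 2 by rewrite divr_gt0.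
  have /cvgrPdist_le /(_ _ e20) /nbhs_ballP[d /= d0 Hd] := cf x.
  have [N _ HN] := near_infty_natSinv_lt (PosNum (divr_gt0 d0 (ltr0Sn R 1))).
  exists (ball x (d / 2), [set n | (N <= n)%N]).
    by split; [apply: nbhsx_ballx; rewrite divr_gt0|exists N].
  case=> x' n [/= xx' Nn] y yx'.
  have yd : `|y - x'| < d / 2 by apply: lt_trans yx' _; exact: HN.
  rewrite /ball /= in xx'.
  have h1 : `|f x - f x'| <= e / 2.
    by apply: Hd; rewrite /ball/=; apply: lt_trans xx' _; lra.
  have h2 : `|f x - f y| <= e / 2.
    apply: Hd; rewrite /ball/= (_ : x - y = (x - x') + (x' - y)); last by ring.
    by apply: le_lt_trans (ler_normD _ _) _; rewrite (distrC x' y); lra.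
  rewrite (_ : f y - f x' = (f x - f x') - (f x - f y)); last by ring.
  by apply: le_trans (ler_normB _ _) _; lra.
move=> [N _ HN]; exists N.+1%:R^-1; first by rewrite invr_gt0.
by move=> x y xab yx; apply: (HN N) => /=.
Qed.

Lemma riemann_sum f a h eta m : continuous f -> 0 <= h ->
  (forall x y, a <= x -> x <= y -> y <= a + m%:R * h -> y - x <= h ->
    `|f y - f x| <= eta) ->
  `|rint a (a + m%:R * h) f - h * \sum_(j < m) f (a + j%:R * h)| <= eta * (m%:R * h).
Proof.
move=> cf h0; elim: m => [|m IH] H.
  rewrite mul0r addr0 big_ord0 !mulr0 subr0.
  rewrite (@eq_rint R a a f (fun=> f a)); last by move=> x /le_anti ->.
  by rewrite rint_cst// subrr mulr0 normr0.
have mh : m.+1%:R * h = m%:R * h + h by rewrite -natr1 mulrDl mul1r.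
have mh0 : 0 <= m%:R * h by rewrite mulr_ge0.
have {}IH : `|rint a (a + m%:R * h) f - h * \sum_(j < m) f (a + j%:R * h)| <= eta * (m%:R * h).
  by apply: IH => x y h1 h2 h3; apply: H => //; rewrite mh addrA; apply: le_trans h3 _; rewrite lerDl.
rewrite mh addrA (@rint_split R a (a + m%:R * h)) ?lerDl//; last exact: cont_within.
rewrite big_ord_recr /= mulrDr.
rewrite [X in `|X|](_ : _ = (rint a (a + m%:R * h) f - h * \sum_(i < m) f (a + i%:R * h)) +
  (rint (a + m%:R * h) (a + m%:R * h + h) f - f (a + m%:R * h) * (a + m%:R * h + h - (a + m%:R * h)))); last by ring.
apply: le_trans (ler_normD _ _) _; rewrite [leRHS]mulrDr; apply: lerD => //.
rewrite [leRHS](_ : _ = eta * (a + m%:R * h + h - (a + m%:R * h))); last by ring.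
apply: rint_approx; [by rewrite lerDl|exact: cont_within|].
move=> x /andP[h1 h2]; apply: H => //; first by rewrite lerDl.
  by rewrite mh addrA.
by rewrite lerBlDl.
Qed.

(** The integrals over [[0, t]] and [[T, T + t]] have the same Riemann sums. *)
Lemma rint_periodic f (T t : R) : continuous f -> (forall x, f (x + T) = f x) ->
  0 <= t -> t <= T -> rint t (t + T) f = rint 0 T f.
Proof.
move=> cf fT t0 tT; have T0 : 0 <= T by exact: le_trans tT.
have cf' a b : {within `[a, b], continuous f} by exact: cont_within.
have TtT : T <= t + T by rewrite lerDr.
rewrite (rint_split t0 tT (cf' _ _)) (rint_split tT TtT (cf' _ _)).
rewrite [RHS]addrC; congr (_ + _).
apply/eqP; rewrite -subr_eq0 -normr_le0; apply/ler_addgt0Pr => e e0; rewrite add0r.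
have eta0 : 0 < e / (2 * (t + 1)) by rewrite divr_gt0// mulr_gt0// ltr_wpDl.
have [dl dl0 Hdl] := segment_unif_cont 0 (T + t) cf eta0.
have [n n0 hn] : exists2 n : nat, (0 < n)%N & t / n%:R < dl.
  exists (Num.truncn (t / dl)).+1 => //; rewrite ltr_pdivrMr// mulrC -ltr_pdivrMr//.
  exact: truncnS_gt.
have nh : n%:R * (t / n%:R) = t by rewrite mulrCA divff ?mulr1// pnatr_eq0 -lt0n.
have h0 : 0 <= t / n%:R by rewrite divr_ge0.
have unif a x y : 0 <= a -> a <= T -> a <= x -> x <= y -> y <= a + n%:R * (t / n%:R) ->
   y - x <= t / n%:R -> `|f y - f x| <= e / (2 * (t + 1)).
  rewrite nh => a0 aT ax xy yat yx; apply: Hdl.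
    by rewrite (le_trans a0)//=; apply: le_trans xy (le_trans yat _); rewrite lerD2r.
  by rewrite ger0_norm ?subr_ge0// (le_lt_trans yx).
have H1 := riemann_sum cf h0 (fun x y => @unif T x y T0 (lexx T)).
have H2 := riemann_sum cf h0 (fun x y => @unif 0 x y (lexx 0) T0).
rewrite nh in H1 H2; rewrite add0r in H2.
have sumE : \sum_(j < n) f (T + j%:R * (t / n%:R)) = \sum_(j < n) f (0 + j%:R * (t / n%:R)).
  by apply: eq_bigr => j _; rewrite addrC fT add0r.
rewrite sumE in H1; move: (t / n%:R * _) H1 H2 => S H1 H2.
rewrite (addrC T) in H1; rewrite (_ : _ - _ = (rint T (t + T) f - S) - (rint 0 t f - S)); last by ring.
apply: le_trans (ler_normB _ _) _; apply: le_trans (lerD H1 H2) _.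
rewrite -mulrDl -mulr2n -[X in X * t](_ : e / (t + 1) = _); last first.
  by field; rewrite gt_eqF// ltr_wpDl.
by rewrite -mulrA ler_piMr ?(ltW e0)// mulrC ler_pdivrMr ?mul1r ?lerDl// ltr_wpDl.
Qed.

End RiemannSums.

(** * Jensen's inequality *)

Section Jensen.
Variable R : realType.
Implicit Types (F G H : R[i] -> R[i]) (r eps : R).

(** The class of functions to which [cint_center] applies; it contains the factor
    [G] of [zero_factor] and is stable under products and rotations. *)
Definition punctured G := ccont G 0 /\
  forall w, 0 < cabs w < 1 -> exists d, cderiv G w d.

Lemma punctured_cst (c : R[i]) : punctured (fun=> c).
Proof.
split=> [e e0|w _]; first by exists 1 => // w _; rewrite subrr cabs0 ltW.
by exists 0 => e e0; exists 1 => // v _; rewrite mul0r subr0 subrr cabs0 mulr_ge0 ?cabs_ge0 ?ltW.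
Qed.

Lemma puncturedM G H : punctured G -> punctured H -> punctured (fun w => G w * H w).
Proof.
move=> [/continuous_ccont cG dG] [/continuous_ccont cH dH]; split.
  apply/continuous_ccont; exact: (@continuousM R[i] R[i]^o G H 0 cG cH).
move=> w w01; have [d /cderiv_derivable dGw] := dG w w01.
have [d' /cderiv_derivable dHw] := dH w w01.
apply: derivable_cderiv; exact: (@derivableM R[i] R[i]^o G H w 1 dGw dHw).
Qed.

Lemma punctured_rot G t : punctured G -> punctured (fun w => G (circ t * w)).
Proof.
move=> [cG dG]; split=> [e /cG[dl dl0 Hd]|w w01].
  by exists dl => // w; rewrite subr0 mulr0 => wd; apply: Hd; rewrite subr0 cabsM cabs_circ mul1r.
have [|d Hd] := dG (circ t * w); first by rewrite cabsM cabs_circ mul1r.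
exists (d * circ t) => e /Hd[dl dl0 H]; exists dl => // v vw.
have E : circ t * v - circ t * w = circ t * (v - w) by rewrite mulrBr.
have := H (circ t * v); rewrite E cabsM cabs_circ mul1r => /(_ vw).
by rewrite mulrA.
Qed.

(** The mean value property of the product of rotations of [G], whose value at 0 is
    a power of [G 0]. *)
Lemma prod_mean_bound G (phi : nat -> R) n r m : punctured G -> 0 < r < 1 ->
  (forall t, 0 <= t <= 2 * pi ->
    \prod_(j < n) cabs (G (r%:C * circ (t + phi j))) <= m) ->
  cabs (G 0) ^+ n <= 2 * m.
Proof.
move=> pG /andP[r0 r1] Hm.
pose Q n w := \prod_(j < n) G (circ (phi j) * w).
have pQ : punctured (Q n).
  elim: n {Hm} => [|n IH]; first by rewrite (_ : Q 0%N = fun=> 1);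
    [exact: punctured_cst|apply/funext => w; rewrite /Q big_ord0].
  rewrite (_ : Q n.+1 = fun w => Q n w * G (circ (phi n) * w)); last first.
    by apply/funext => w; rewrite /Q big_ord_recr.
  by apply: puncturedM => //; exact: punctured_rot.
have Q0 : Q n 0 = G 0 ^+ n.
  by rewrite /Q; under eq_bigr do rewrite mulr0; rewrite prodr_const card_ord.
have mean := cint_center pQ.2 pQ.1 r0 r1.
have pi0 : 0 < 2 * pi :> R by rewrite mulr_gt0 ?pi_gt0.
rewrite -(ler_pM2r pi0).
have <- : cabs (Q n 0 * (2 * pi)%:C) = cabs (G 0) ^+ n * (2 * pi).
  by rewrite Q0 cabsM cabsX cabsR gtr0_norm.
rewrite -mean; apply: cabs_cint_le.
  apply: pathc_on_circle; last exact: ltW.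
  by move=> w wr; have [|d /cderiv_ccont//] := pQ.2 w; rewrite wr r0.
move=> t t02; apply: le_trans (Hm t t02); rewrite le_eqVlt; apply/orP; left; apply/eqP.
rewrite /Q; elim: (n) => [|k IH]; first by rewrite !big_ord0 cabs1.
by rewrite !big_ord_recr /= cabsM IH circD (mulrC (circ t)) mulrCA.
Qed.

Definition logmod G r eps t := ln (cabs (G (r%:C * circ t)) ^+ 2 + eps).

Lemma logmod_continuous G r eps : punctured G -> 0 < r < 1 -> 0 < eps ->
  continuous (logmod G r eps).
Proof.
move=> pG /andP[r0 r1] e0 t.
have cG : {for t, continuous (fun t => cabs (G (r%:C * circ t)))}.
  apply: pcont_cabs; apply: (@pathc_on_circle R G r); last exact: ltW.
  by move=> w wr; have [|d /cderiv_ccont//] := pG.2 w; rewrite wr r0.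
apply: (@continuous_comp _ _ _ (fun t => cabs (G (r%:C * circ t)) ^+ 2 + eps) (@ln R)).
  apply: (@continuousD R R^o R (fun t => cabs (G (r%:C * circ t)) ^+ 2) (fun=> eps)).
    exact: (@continuousM R R (fun t => cabs (G (r%:C * circ t))) (fun t => cabs (G (r%:C * circ t))) t cG cG).
  exact: cst_continuous.
by apply: continuous_ln; rewrite ltr_wpDl// exprn_ge0// cabs_ge0.
Qed.

(** Take [n] equally spaced rotations in [prod_mean_bound].  The logarithm of the
    squared product is at most a Riemann sum of [logmod G r eps], which is within
    [n e / (2 T)] of [n / T] times its integral, uniformly in the starting point.
    Dividing by [n] makes the factor 2 of [prod_mean_bound] disappear. *)
Lemma jensen G r eps : punctured G -> G 0 != 0 -> 0 < r < 1 -> 0 < eps ->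
  2 * ln (cabs (G 0)) * (2 * pi) <= rint 0 (2 * pi) (logmod G r eps).
Proof.
move=> pG G0 r01 eps0; set u := logmod G r eps; set J := rint _ _ _.
have pi0 : 0 < 2 * pi :> R by rewrite mulr_gt0 ?pi_gt0.
have [T TE] : exists T : R, T = 2 * pi by exists (2 * pi).
rewrite /J -TE in pi0 *; rewrite -/u; set J' := rint 0 T u.
have cu : continuous u by exact: logmod_continuous.
have uT x : u (x + T) = u x by rewrite /u /logmod circD TE circ2pi mulr1.
have c0 : 0 < cabs (G 0) by rewrite cabs_gt0.
apply/ler_addgt0Pr => e e0.
have eta0 : 0 < e / (2 * T) by rewrite divr_gt0// mulr_gt0.
have [dl dl0 Hdl] := segment_unif_cont 0 (T + T) cu eta0.
(* [n >= c1] makes the contribution [ln 2] of that factor at most [e / 2] *)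
pose c1 := 4 * ln 2 * T / e.
pose n := (maxn (Num.truncn (T / dl)) (Num.truncn c1)).+1.
have n0 : 0 < n%:R :> R by rewrite ltr0n.
have hn : T / n%:R < dl.
  rewrite ltr_pdivrMr// mulrC -ltr_pdivrMr//; apply: lt_le_trans (truncnS_gt _) _.
  by rewrite ler_nat /n ltnS leq_maxl.
have cn : c1 <= n%:R.
  apply: ltW; apply: lt_le_trans (truncnS_gt _) _.
  by rewrite ler_nat /n ltnS leq_maxr.
have nh : n%:R * (T / n%:R) = T by rewrite mulrCA divff ?mulr1// gt_eqF.
have h0 : 0 <= T / n%:R by rewrite divr_ge0// ltW.
pose K := n%:R / T * J' + n%:R * (e / (2 * T)).
have HK t : 0 <= t <= T -> \sum_(j < n) u (t + j%:R * (T / n%:R)) <= K.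
  move=> /andP[t0 tT].
  have unif x y : t <= x -> x <= y -> y <= t + n%:R * (T / n%:R) -> y - x <= T / n%:R ->
      `|u y - u x| <= e / (2 * T).
    rewrite nh => tx xy yt yx; apply: Hdl.
      by rewrite (le_trans t0)//=; apply: le_trans xy (le_trans yt _); rewrite lerD2r.
    by rewrite ger0_norm ?subr_ge0// (le_lt_trans yx).
  have := riemann_sum cu h0 unif; rewrite nh rint_periodic// -/J'.
  move: (\sum_(j < n) _) => S; rewrite ler_norml => /andP[H _].
  have {}H : T / n%:R * S <= J' + e / (2 * T) * T by move: H; lra.
  rewrite -(ler_pM2l (x := T / n%:R)) ?divr_gt0//; apply: le_trans H _.
  rewrite le_eqVlt; apply/orP; left; apply/eqP.
  by rewrite /K; field; rewrite !gt_eqF.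
have Hc : cabs (G 0) ^+ n <= 2 * expR (K / 2).
  apply: (prod_mean_bound (phi := fun j => j%:R * (T / n%:R)) pG r01) => t.
  rewrite -TE => t0T.
  rewrite -(@ler_pXn2r _ 2)// ?nnegrE ?expR_ge0 ?prodr_ge0//; last by move=> *; exact: cabs_ge0.
  rewrite -expRM_natl (_ : 2%:R * (K / 2) = K); last by field.
  apply: le_trans (_ : expR (\sum_(j < n) u (t + j%:R * (T / n%:R))) <= _); last by rewrite ler_expR HK.
  rewrite expR_sum -prodrXl; apply: ler_prod => j _.
  rewrite exprn_ge0 ?cabs_ge0//= /u /logmod lnK ?lerDl ?ltW//.
  by rewrite posrE ltr_wpDl// exprn_ge0// cabs_ge0.
have {}Hc : n%:R * ln (cabs (G 0)) <= ln 2 + K / 2.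
  have := Hc; rewrite -ler_ln ?posrE ?exprn_gt0 ?mulr_gt0 ?expR_gt0//.
  by rewrite lnXn// lnM ?posrE ?expR_gt0// expRK mulr_natl.
have c1E : 4 * ln 2 * T = c1 * e by rewrite /c1 divfK// gt_eqF.
rewrite -(ler_pM2l n0).
have KE : K * T = n%:R * (J' + e / 2).
  by rewrite /K; field; rewrite !gt_eqF.
have : n%:R * ln (cabs (G 0)) * (2 * T) <= (ln 2 + K / 2) * (2 * T).
  by rewrite ler_pM2r// mulr_gt0.
have -> : (ln 2 + K / 2) * (2 * T) = c1 * e / 2 + n%:R * (J' + e / 2).
  by rewrite -c1E -KE; field.
have : c1 * e <= n%:R * e by rewrite ler_pM2r.
move: n0; move: (n%:R : R) => N; move: (c1 * e) => W.
nra.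
Qed.

End Jensen.

(** * Nonvanishing of boundary values *)

Section BoundaryUniqueness.
Variable R : realType.
Implicit Types (F G H : R[i] -> R[i]) (f : R[i] -> R[i]) (r eps : R).
Notation mu := (@lebesgue_measure R).

Lemma ae_filter : Filter (nbhs (almost_everywhere mu)).
Proof. exact: ae_filter_ringOfSetsType. Qed.

Lemma radial_limitP F (z l : R[i]) :
  ((fun r : R => (F (r%:C * z)%R : R[i]^o)) @ 1^'- --> (l : R[i]^o)) <->
  forall e : R, 0 < e -> exists2 dl : R, 0 < dl &
    forall r, 1 - dl < r < 1 -> cabs (F (r%:C * z) - l) <= e.
Proof.
have cvgP := @cvgC_P R _ (1^'-) _ (fun r : R => F (r%:C * z)) l.
split=> [/cvgP H e /H|H].
  move=> /nbhs_ballP[dl /= dl0 Hd]; exists dl => // r /andP[r1 r2].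
  by apply: Hd => //; rewrite /ball /= ger0_norm ?subr_ge0 ?(ltW r2)//; lra.
apply/cvgP => e /H[dl dl0 Hd]; apply/nbhs_ballP; exists dl => // r.
rewrite /ball /= ltr_norml => /andP[h1 h2] r1; apply: Hd; rewrite r1 andbT; lra.
Qed.

Lemma rcircle_continuous F r : analytic_disc F -> 0 <= r < 1 ->
  pathc (fun t => F (r%:C * circ t)).
Proof.
move=> aF /andP[r0 r1]; apply: pathc_on_circle => // w wr.
by have [|d /cderiv_ccont//] := analytic_cderiv aF (w := w); rewrite wr.
Qed.

Lemma continuous_squared (g : R -> R) : continuous g -> continuous (fun t => g t ^+ 2).
Proof. by move=> cg t; exact: (@continuousM R R g g t (cg t) (cg t)). Qed.

Lemma continuous_rescale (c : R) (g : R -> R) : continuous g -> continuous (fun t => c * g t).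
Proof.
by move=> cg t; apply: (@continuousM R R (fun=> c) g t _ (cg t)); exact: cst_continuous.
Qed.

Lemma cabs2_continuous F r : analytic_disc F -> 0 <= r < 1 ->
  continuous (fun t => cabs (F (r%:C * circ t)) ^+ 2).
Proof.
move=> aF r01; apply: continuous_squared => t; apply: pcont_cabs.
exact: rcircle_continuous.
Qed.

Lemma sqint_circle F r : analytic_disc F -> 0 <= r < 1 ->
  sqint (fun z => F (r%:C * z)%R) =
  (rint 0 (2 * pi) (fun t => cabs (F (r%:C * circ t)) ^+ 2))%:E.
Proof.
move=> aF r01; rewrite /sqint rint_EFin//.
by apply: cont_within; exact: cabs2_continuous.
Qed.

Definition rad_seq (n : nat) : R := 1 - n.+2%:R^-1.

Lemma rad_seq_bnd n : 1 / 2 <= rad_seq n < 1.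
Proof.
rewrite /rad_seq; have h : (n.+2%:R : R)^-1 <= 2^-1 by rewrite lef_pV2 ?posrE ?ltr0n// ler_nat.
have h0 : 0 < (n.+2%:R : R)^-1 by rewrite invr_gt0.
by move: (n.+2%:R^-1) h h0 => x h h0; apply/andP; split; lra.
Qed.

Lemma rad_seq_near dl : 0 < dl -> exists N, forall n, (N <= n)%N -> 1 - dl < rad_seq n < 1.
Proof.
move=> dl0; exists (Num.truncn dl^-1) => n Nn; have /andP[_ ->] := rad_seq_bnd n.
rewrite andbT /rad_seq ltrD2l ltrN2 invf_plt ?posrE//.
by apply: lt_le_trans (truncnS_gt _) _; rewrite ler_nat; apply: (leq_trans _ (leqnSn _)).
Qed.

Lemma limn_einf_le (u : nat -> \bar R) (C : \bar R) : (forall n, u n <= C)%E -> (limn_einf u <= C)%E.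
Proof.
move=> uC; rewrite limn_einf_lim; apply: lime_le; first exact: is_cvg_einfs.
apply: nearW => n; apply: le_trans (uC n).
by apply: ereal_inf_lbound; exists n => /=.
Qed.

(** Were [f] zero on a set of positive measure, the functions [v n] below would tend to
    infinity on it, whereas their integrals are bounded by [C]: the integral of
    [|G|^2] is controlled by the Hardy norm of [F], and that of the logarithm by
    Jensen's inequality. *)
Lemma boundary_neq0 F f z0 : Hardy2_disc F -> boundary_values F f ->
  disc z0 -> F z0 != 0 -> ae_circle (fun z => f z != 0).
Proof.
move=> [aF [M HM]] bF z01 Fz0.
have [k [G [G0 cG dG FG]]] := zero_factor aF z01 Fz0.
have pG : punctured G by split.
have r01 n : 0 < rad_seq n < 1.
  by have /andP[h ->] := rad_seq_bnd n; rewrite andbT; lra.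
have r01' n : 0 <= rad_seq n < 1 by have /andP[/ltW -> ->] := r01 n.
(* [eps n <= 1] gives [0 <= v n], and [eps n] tending to 0 makes [v n] blow up *)
pose eps (n : nat) : R := n.+1%:R^-1.
have eps0 n : 0 < eps n by rewrite /eps invr_gt0.
have eps1 n : eps n <= 1 by rewrite /eps invf_le1// ler1n.
pose sq n t := cabs (G ((rad_seq n)%:C * circ t)) ^+ 2.
pose v n t := sq n t - logmod G (rad_seq n) (eps n) t.
have rc0 n t : (rad_seq n)%:C * circ t != 0.
  by rewrite mulf_neq0 ?circ_neq0// fmorph_eq0 gt_eqF//; case/andP: (r01 n).
(* [4 ^ k] because the radii are at least 1/2 *)
have sqE n t : sq n t <= 4 ^+ k * cabs (F ((rad_seq n)%:C * circ t)) ^+ 2.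
  rewrite FG// !cabsM cabsX cabs_rcirc; last by case/andP: (r01' n).
  rewrite exprMn mulrA ler_peMl ?exprn_ge0 ?cabs_ge0//.
  rewrite -exprM mulnC exprM -exprMn; apply: exprn_ege1.
  by have /andP[h _] := rad_seq_bnd n; nra.
have csq n : continuous (sq n).
  apply: continuous_squared => t; apply: pcont_cabs.
  apply: (@pathc_on_circle R G (rad_seq n)); last by case/andP: (r01' n).
  by move=> w wr; have [|d /cderiv_ccont//] := dG w; rewrite wr.
have cl n : continuous (logmod G (rad_seq n) (eps n)) by exact: logmod_continuous.
have cv n : continuous (v n).
  by move=> t; exact: (@continuousB R R^o R (sq n) (logmod G (rad_seq n) (eps n)) t (csq n t) (cl n t)).
have v0 n t : 0 <= v n t.
  rewrite /v /logmod -/(sq n t) subr_ge0.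
  have s0 : 0 <= sq n t by rewrite exprn_ge0 ?cabs_ge0.
  rewrite (_ : sq n t + eps n = 1 + (sq n t + eps n - 1)); last by ring.
  apply: le_trans (le_ln1Dx _) _; first by have := eps0 n; lra.
  by have := eps1 n; lra.
pose C := 4 ^+ k * M - 2 * ln (cabs (G 0)) * (2 * pi).
have vC n : (\int[mu]_(t in `[0%R, (2 * pi)%R]) (v n t)%:E <= C%:E)%E.
  rewrite rint_EFin; last exact: cont_within.
  rewrite lee_fin /v rintB; [|exact: cont_within|exact: cont_within].
  apply: lerB; last exact: jensen.
  have cF2 := cabs2_continuous aF (r01' n).
  have := HM _ (r01' n); rewrite sqint_circle// lee_fin => HMn.
  apply: le_trans (_ : 4 ^+ k * rint 0 (2 * pi) (fun t => cabs (F ((rad_seq n)%:C * circ t)) ^+ 2) <= _); last first.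
    by rewrite ler_wpM2l// exprn_ge0.
  rewrite -rintZ; last exact: cont_within.
  apply: le_rint => [| |t _]; [exact: cont_within| |exact: sqE].
  by apply: cont_within; exact: continuous_rescale.
have mv n : measurable_fun `[0, 2 * pi] (EFin \o v n).
  by apply: (measurable_int mu); apply: cont_integrable; exact: cont_within.
have fat : (\int[mu]_(t in `[0%R, (2 * pi)%R]) limn_einf (fun n => (v n t)%:E) <= C%:E)%E.
  apply: le_trans (fatou mu (measurable_itv _) mv _) _; last exact: limn_einf_le.
  by move=> n t _; rewrite lee_fin.
have L0 t : (0 <= limn_einf (fun n => (v n t)%:E))%E.
  rewrite limn_einf_lim; apply: lime_ge; first exact: is_cvg_einfs.
  by apply: nearW => n; apply: le_ereal_inf_tmp => _ [m /= _ <-]; rewrite lee_fin.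
have iL : mu.-integrable `[0, 2 * pi] (fun t => limn_einf (fun n => (v n t)%:E)).
  apply/integrableP; split.
    rewrite /limn_einf; apply: measurableT_comp => //.
    apply: measurable_fun_limn_esup => n; apply: measurableT_comp => //; exact: mv.
  under eq_integral do rewrite gee0_abs//.
  by apply: le_lt_trans fat _; rewrite ltry.
have Lae : {ae mu, forall t : R, t \in `[0, 2 * pi] ->
    limn_einf (fun n => (v n t)%:E) \is a fin_num}.
  by apply: integrable_ae iL; exact: measurable_itv.
rewrite /boundary_values /ae_circle in bF *.
apply: (@filterS2 _ _ ae_filter _ _ _ _ Lae bF) => t Lt Ft t02.
apply/eqP => ft0; have := Lt t02; have {}Ft := Ft t02; rewrite ft0 in Ft.
suff -> : limn_einf (fun n => (v n t)%:E) = +oo%E by [].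
apply: (cvg_limn_einf_sup _).1; apply/cvgeyPger => A _.
(* here [|G|^2] and [eps n] are both at most [expR (- A) / 2], so [A <= v n] *)
have d0 : 0 < expR (- A) by exact: expR_gt0.
set dt := expR (- A) in d0.
have e0 : 0 < Num.min 1 (dt / (2 * 4 ^+ k)).
  by rewrite lt_min ltr01 divr_gt0// mulr_gt0// exprn_gt0.
have /radial_limitP /(_ _ e0) [dl dl0 Hd] := Ft.
have [N1 HN1] := rad_seq_near dl0.
exists (maxn N1 (Num.truncn (2 / dt))) => // n /=; rewrite geq_max => /andP[n1 n2].
have := Hd _ (HN1 n n1); rewrite subr0 le_min => /andP[F1 F2].
have eN : eps n <= dt / 2.
  rewrite /eps -(invf_div 2 dt) lef_pV2 ?posrE ?divr_gt0 ?ltr0n//.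
  by apply: ltW; apply: lt_le_trans (truncnS_gt _) _; rewrite ler_nat.
have sN : sq n t <= dt / 2.
  apply: le_trans (sqE n t) _; rewrite mulrC -ler_pdivlMr ?exprn_gt0//.
  rewrite -mulrA -invfM expr2; apply: le_trans F2.
  by rewrite ler_piMl ?cabs_ge0.
rewrite lee_fin /v /logmod -/(sq n t).
have s0 : 0 <= sq n t by rewrite exprn_ge0 ?cabs_ge0.
have : ln (sq n t + eps n) <= ln dt.
  by rewrite ler_ln ?posrE ?ltr_wpDl//; lra.
by rewrite /dt expRK; lra.
Qed.

End BoundaryUniqueness.

(** * Operations on Hardy functions and boundary values *)

Section HardyClosure.
Variable R : realType.
Implicit Types (A B F G H : R[i] -> R[i]) (a b f g h phi : R[i] -> R[i]) (P Q : R[i] -> Prop).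
Notation mu := (@lebesgue_measure R).

Lemma ae_circleS P Q : (forall z, P z -> Q z) -> ae_circle P -> ae_circle Q.
Proof.
move=> PQ; rewrite /ae_circle => HP.
by apply: (@filterS _ _ (ae_filter R) _ _ _ HP) => t Pt t02; apply/PQ/Pt.
Qed.

Lemma ae_circleI P Q : ae_circle P -> ae_circle Q -> ae_circle (fun z => P z /\ Q z).
Proof.
rewrite /ae_circle => HP HQ.
by apply: (@filterS2 _ _ (ae_filter R) _ _ _ _ HP HQ) => t Pt Qt t02; split; [exact: Pt|exact: Qt].
Qed.

Lemma ae_circleT P : (forall z, P z) -> ae_circle P.
Proof.
by move=> HP; rewrite /ae_circle; apply: (@nearW _ _ _ (ae_filter R)) => t _; exact: HP.
Qed.

(** An interval of length [2 pi] is not negligible. *)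
Lemma ae_circle_exists P : ae_circle P -> exists z, P z.
Proof.
move=> aeP; apply: contrapT => /forallNP nP.
have : mu `[0, 2 * pi]%classic = 0%E.
  apply: measure_negligible; first exact: measurable_itv.
  by apply: negligibleS aeP => t /= t02; move=> /(_ t02); exact: nP.
rewrite /= lebesgue_measure_itv /= lte_fin mulr_gt0 ?pi_gt0// sube0 => /eqP.
by rewrite eqe => /eqP; have := pi_gt0 R; lra.
Qed.

Lemma boundary_values_ext F f g : eq_circle f g -> boundary_values F f -> boundary_values F g.
Proof.
by move=> fg bF; apply: ae_circleS (ae_circleI fg bF) => z [->].
Qed.

Lemma radial_limitM F G (z l m : R[i]) :
  ((fun r : R => (F (r%:C * z)%R : R[i]^o)) @ 1^'- --> (l : R[i]^o)) ->
  ((fun r : R => (G (r%:C * z)%R : R[i]^o)) @ 1^'- --> (m : R[i]^o)) ->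
  ((fun r : R => ((F (r%:C * z) * G (r%:C * z))%R : R[i]^o)) @ 1^'- --> ((l * m)%R : R[i]^o)).
Proof.
move=> Fl Gm; exact: (@cvgM R[i] R (1^'-) _ (fun r : R => F (r%:C * z)) (fun r : R => G (r%:C * z)) l m Fl Gm).
Qed.

Lemma boundary_valuesM F G f g : boundary_values F f -> boundary_values G g ->
  boundary_values (fun z => F z * G z) (fun z => f z * g z).
Proof.
move=> bF bG; apply: ae_circleS (ae_circleI bF bG) => z [Fz Gz].
exact: radial_limitM.
Qed.

Lemma boundary_valuesB F G f g : boundary_values F f -> boundary_values G g ->
  boundary_values (fun z => F z - G z) (fun z => f z - g z).
Proof.
move=> bF bG; apply: ae_circleS (ae_circleI bF bG) => z [Fz Gz].
exact: (@cvgB R[i] R[i]^o R (1^'-) _ (fun r : R => F (r%:C * z)) (fun r : R => G (r%:C * z)) _ _ Fz Gz).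
Qed.

(** Close to a boundary point where [b] is nonzero, [B] is nonzero on the radius and
    [F] is the quotient [H / B]. *)
Lemma boundary_values_div F B H f b : boundary_values B b -> boundary_values H f ->
  ae_circle (fun z => b z != 0) -> (forall z, disc z -> H z = B z * F z) ->
  boundary_values F (fun z => f z / b z).
Proof.
move=> bB bH b0 HBF.
have circ1 : ae_circle (fun z : R[i] => cabs z = 1).
  rewrite /ae_circle; apply: (@nearW _ _ _ (ae_filter R)) => t _; exact: cabs_circ.
apply: ae_circleS (ae_circleI (ae_circleI bB bH) (ae_circleI b0 circ1)) => z [[Bz Hz] [bz z1]].
have BVz : (fun r : R => ((B (r%:C * z))^-1 : R[i]^o)) @ 1^'- --> ((b z)^-1 : R[i]^o).
  exact: (@cvgV R[i] R (1^'-) _ (fun r : R => B (r%:C * z)) _ bz Bz).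
have lim := (radial_limitP (fun w => H w / B w) z (f z / b z)).1
  (@radial_limitM H (fun w => (B w)^-1) z _ _ Hz BVz).
 apply/radial_limitP => e /lim[dl dl0 Hd].
have b20 : 0 < cabs (b z) / 2 by rewrite divr_gt0 ?cabs_gt0.
have [dl' dl'0 Hd'] := (radial_limitP _ _ _).1 Bz _ b20.
exists (Num.min (Num.min dl dl') 1); first by rewrite !lt_min dl0 dl'0 ltr01.
move=> r; rewrite ltrBlDr -ltrBlDl !lt_min => /andP[/andP[/andP[r1 r2] r3] r4].
have rd : disc (r%:C * z).
  by rewrite /disc /= cabsM z1 mulr1 cabsR ger0_norm//; lra.
have Br0 : B (r%:C * z) != 0.
  have /Hd' : 1 - dl' < r < 1 by rewrite r4 andbT; lra.
  apply: contraTneq => ->; rewrite sub0r cabsN -ltNge ltr_pdivrMr// ltr_pMr ?ltr1n//.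
  by rewrite cabs_gt0.
have /Hd : 1 - dl < r < 1 by rewrite r4 andbT; lra.
by rewrite HBF// mulrAC divff// mul1r.
Qed.

Lemma analytic_discM F G : analytic_disc F -> analytic_disc G -> analytic_disc (fun z => F z * G z).
Proof.
move=> aF aG z z1; exact: (@derivableM R[i] R[i]^o F G z 1 (aF z z1) (aG z z1)).
Qed.

Lemma analytic_discB F G : analytic_disc F -> analytic_disc G -> analytic_disc (fun z => F z - G z).
Proof.
move=> aF aG z z1; exact: (@derivableB R[i] R[i]^o R[i]^o F G z 1 (aF z z1) (aG z z1)).
Qed.

Lemma analytic_disc_local F : (forall z, disc z -> exists G, [/\ exists d, cderiv G z d, G z = F z &
    exists2 dl : R, 0 < dl & forall w, cabs (w - z) < dl -> F w = G w]) -> analytic_disc F.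
Proof.
move=> loc z /loc[G [[d dG] Gz [dl dl0 FG]]]; apply: (@cderiv_derivable R F z d) => e /dG[dl' dl'0 H].
exists (Num.min dl dl'); first by rewrite lt_min dl0.
by move=> w; rewrite lt_min => /andP[w1 w2]; rewrite FG// -Gz; exact: H.
Qed.

(** From [(C (x + y))^2 <= 2 C^2 x^2 + 2 C^2 y^2] on each circle.  Differences, products
    by bounded functions and the quotient of [coprime_division] are all instances. *)
Lemma Hardy2_dominated F G H (C : R) : analytic_disc F -> Hardy2_disc G -> Hardy2_disc H ->
  (forall z, disc z -> cabs (F z) <= C * (cabs (G z) + cabs (H z))) -> Hardy2_disc F.
Proof.
move=> aF [aG [M HM]] [aH [N HN]] FGH; split=> //.
exists (2 * C ^+ 2 * M + 2 * C ^+ 2 * N) => r r01.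
have := HM r r01; have := HN r r01; rewrite !sqint_circle// !lee_fin => HNr HMr.
have cG := cabs2_continuous aG r01; have cH := cabs2_continuous aH r01.
have C2 : 0 <= 2 * C ^+ 2 by rewrite mulr_ge0// sqr_ge0.
apply: le_trans (lerD (ler_wpM2l C2 HMr) (ler_wpM2l C2 HNr)).
rewrite -!rintZ; [|exact: cont_within|exact: cont_within].
have cCG := continuous_rescale (c := 2 * C ^+ 2) cG.
have cCH := continuous_rescale (c := 2 * C ^+ 2) cH.
rewrite -rintD; [|exact: cont_within|exact: cont_within].
apply: le_rint.
- by apply: cont_within; exact: cabs2_continuous.
- apply: cont_within => t; exact: (@continuousD R R^o R _ _ t (cCG t) (cCH t)).
move=> t _; set w := _ * circ t.
have wr : cabs w = r by rewrite cabs_rcirc//; case/andP: r01.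
have /FGH Fw : disc w by change (cabs w < 1); rewrite wr; case/andP: r01.
apply: (@le_trans _ _ ((C * (cabs (G w) + cabs (H w))) ^+ 2)).
  by rewrite ler_pXn2r// nnegrE ?cabs_ge0// (le_trans (cabs_ge0 _) Fw).
rewrite -subr_ge0 (_ : _ - _ = (C * (cabs (G w) - cabs (H w))) ^+ 2); last by ring.
exact: sqr_ge0.
Qed.

Lemma HinfM A F : Hinf_disc A -> Hardy2_disc F -> Hardy2_disc (fun z => A z * F z).
Proof.
move=> [aA [M HM]] HF; apply: (@Hardy2_dominated _ F F M); [|exact: HF|exact: HF|].
  by apply: analytic_discM; [exact: aA|case: HF].
move=> z z1; rewrite cabsM; apply: (@le_trans _ _ (M * cabs (F z))).
  by rewrite ler_wpM2r ?cabs_ge0// HM.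
by rewrite ler_wpM2l ?lerDl ?cabs_ge0// (le_trans (cabs_ge0 _) (HM z z1)).
Qed.

Lemma Hardy2B F G : Hardy2_disc F -> Hardy2_disc G -> Hardy2_disc (fun z => F z - G z).
Proof.
move=> HF HG; apply: (@Hardy2_dominated _ F G 1); [|exact: HF|exact: HG|].
  by apply: analytic_discB; [case: HF|case: HG].
by move=> z _; rewrite mul1r cabsB.
Qed.

Lemma Hinf_Hardy2 F : Hinf_disc F -> Hardy2_disc F.
Proof.
move=> HF; have -> : F = (fun z => F z * 1) by apply/funext => z; rewrite mulr1.
apply: HinfM; [exact: HF|split].
  move=> z _; apply: (@cderiv_derivable R (fun=> 1) z 0) => e e0.
  by exists 1 => // w _; rewrite subrr mul0r subr0 cabs0 mulr_ge0 ?cabs_ge0 ?ltW.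
exists (2 * pi) => r _; rewrite /sqint.
under eq_integral do rewrite cabs1 expr1n.
rewrite integral_cst//= lebesgue_measure_itv /= lte_fin mulr_gt0 ?pi_gt0//.
by rewrite sube0 mul1e.
Qed.

End HardyClosure.

(** * Square integrability of boundary functions *)

Section BoundarySquareIntegrable.
Variable R : realType.
Implicit Types (F : R[i] -> R[i]) (f phi : R[i] -> R[i]).
Notation mu := (@lebesgue_measure R).

Lemma rad_seq_cvg F (z l : R[i]) :
  ((fun r : R => (F (r%:C * z)%R : R[i]^o)) @ 1^'- --> (l : R[i]^o)) ->
  forall e : R, 0 < e -> exists N, forall n, (N <= n)%N -> cabs (F ((rad_seq R n)%:C * z) - l) <= e.
Proof.
move=> /radial_limitP H e /H[dl /rad_seq_near[N HN] Hd].
by exists N => n /HN; exact: Hd.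
Qed.

Lemma eps_cvgn (u : nat -> R) (l : R) :
  (forall e : R, 0 < e -> exists N, forall n, (N <= n)%N -> `|u n - l| <= e) -> u @ \oo --> l.
Proof.
move=> H; apply/cvgrPdist_le => e /H[N HN]; exists N => // n /= /HN.
by rewrite distrC.
Qed.

Lemma cvgn_EFin (u : nat -> R) (l : R) : u @ \oo --> l -> (fun n => (u n)%:E) @ \oo --> l%:E.
Proof. by move=> ul; apply/fine_cvgP; split; first exact: nearW. Qed.

(** The upper limits of the real and imaginary parts of [F] along radii tending to 1
    form a measurable representative of [f], and Fatou's lemma bounds its norm.
    Membership in [Hplus] and [Hminus] thus depends only on the analytic extension
    ([HplusE], [HminusE]). *)
Lemma L2_boundary F f : Hardy2_disc F -> boundary_values F f -> L2_circle f.
Proof.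
move=> [aF [M HM]] bF.
have r01 n : 0 <= rad_seq R n < 1 by have /andP[h ->] := rad_seq_bnd R n; rewrite andbT; lra.
pose re n z := complex.Re (F ((rad_seq R n)%:C * z)).
pose im n z := complex.Im (F ((rad_seq R n)%:C * z)).
pose psi z := fine (limn_esup (fun n => (re n z)%:E)) +i* fine (limn_esup (fun n => (im n z)%:E)).
have pF n := rcircle_continuous aF (r01 n).
have mre : measurable_fun `[0, 2 * pi] (fun t => complex.Re (psi (circ t))).
  rewrite /psi /=; apply: measurableT_comp; first exact: fine_measurable.
  apply: measurable_fun_limn_esup => n; apply: (measurable_int mu); apply: cont_integrable.
  exact: pathc_Re.
have mim : measurable_fun `[0, 2 * pi] (fun t => complex.Im (psi (circ t))).
  rewrite /psi /=; apply: measurableT_comp; first exact: fine_measurable.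
  apply: measurable_fun_limn_esup => n; apply: (measurable_int mu); apply: cont_integrable.
  exact: pathc_Im.
have fpsi : eq_circle f psi.
  apply: ae_circleS bF => z /rad_seq_cvg H.
  have lim u l : (forall e : R, 0 < e -> exists N, forall n, (N <= n)%N -> `|u n - l| <= e) ->
      fine (limn_esup (fun n => (u n)%:E)) = l.
    by move=> /eps_cvgn/cvgn_EFin ul; rewrite (cvg_limn_einf_sup ul).2.
  rewrite /psi (lim (re^~ z) (complex.Re (f z))); last first.
    move=> e /H[N HN]; exists N => n /HN; apply: le_trans.
    by rewrite /re -cReB; exact: normRe_cabs.
  rewrite (lim (im^~ z) (complex.Im (f z))); first by case: (f z).
  move=> e /H[N HN]; exists N => n /HN; apply: le_trans.
  by rewrite /im -cImB; exact: normIm_cabs.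
exists psi; split => //.
pose sq n t := cabs (F ((rad_seq R n)%:C * circ t)) ^+ 2.
have csq n : continuous (sq n) by exact: cabs2_continuous.
have msq n : measurable_fun `[0, 2 * pi] (EFin \o sq n).
  by apply: (measurable_int mu); apply: cont_integrable; exact: cont_within.
have fat : (\int[mu]_(t in `[0%R, (2 * pi)%R]) limn_einf (fun n => (sq n t)%:E) <= M%:E)%E.
  apply: le_trans (fatou mu (measurable_itv _) msq _) _.
    by move=> n t _; rewrite /= lee_fin exprn_ge0 ?cabs_ge0.
  by apply: limn_einf_le => n; have := HM _ (r01 n); rewrite /sqint.
apply: le_lt_trans (ltry M); apply: le_trans fat.
rewrite /sqint le_eqVlt; apply/orP; left; apply/eqP.
apply: ge0_ae_eq_integral; first exact: measurable_itv.
- rewrite (_ : (fun t => (cabs (psi (circ t)) ^+ 2)%:E) = EFin \o (fun t =>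
    complex.Re (psi (circ t)) ^+ 2 + complex.Im (psi (circ t)) ^+ 2)); last first.
    by apply/funext => t; congr EFin; exact: cabs_sqr.
  apply/measurable_EFinP.
  by apply: measurable_funD; apply: measurable_funX.
- rewrite /limn_einf; apply: measurableT_comp => //.
  by apply: measurable_fun_limn_esup => n; apply: measurableT_comp => //; exact: msq.
- by move=> t _; rewrite lee_fin exprn_ge0 ?cabs_ge0.
- move=> t _; rewrite limn_einf_lim; apply: lime_ge; first exact: is_cvg_einfs.
  by apply: nearW => n; apply: le_ereal_inf_tmp => _ [m /= _ <-]; rewrite lee_fin exprn_ge0 ?cabs_ge0.
have := ae_circleI fpsi bF; rewrite /ae_circle.
apply: (@filterS _ _ (ae_filter R)) => t Ht t02; have [fp /rad_seq_cvg H] := Ht t02.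
apply/esym; apply: (cvg_limn_einf_sup _).1.
apply: cvgn_EFin; rewrite -fp.
have cn : (fun n => cabs (F ((rad_seq R n)%:C * circ t))) @ \oo --> cabs (f (circ t)).
  apply: eps_cvgn => e /H[N HN]; exists N => n /HN; apply: le_trans.
  by rewrite ler_norml lerNl opprB cabs_dist lerB_cabs /= cabs_dist lerB_cabs.
exact: (cvgM cn cn).
Qed.

End BoundarySquareIntegrable.

(** * Division of coprime multipliers *)

Section Coprime.
Variable R : realType.
Implicit Types (A B F G H : R[i] -> R[i]) (a b f g h phi : R[i] -> R[i]).

Lemma conjcM (z w : R[i]) : conjc (z * w) = conjc z * conjc w.
Proof. exact: (rmorphM (@conjc R)). Qed.

Lemma HplusE phi : Hplus phi <-> exists2 F, Hardy2_disc F & boundary_values F phi.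
Proof.
split=> [[_ []]|[F HF bF]]; first by move=> F HF bF; exists F.
by split; [exact: L2_boundary HF bF|exists F].
Qed.

Lemma L2_circle_conj phi : L2_circle (fun z => (phi z)^*) -> L2_circle phi.
Proof.
move=> [psi [mre mim sq eqp]]; exists (fun z => (psi z)^*); split.
- have -> : (fun t => complex.Re (psi (circ t))^*) = (fun t => complex.Re (psi (circ t))).
    by apply/funext => t; case: (psi _).
  exact: mre.
- have -> : (fun t => complex.Im (psi (circ t))^*) = -%R \o (fun t => complex.Im (psi (circ t))).
    by apply/funext => t; rewrite /comp; case: (psi _).
  by apply: measurableT_comp.
- rewrite (_ : sqint _ = sqint psi)//; apply: eq_integral => t _.
  by rewrite cabs_conj.
- by apply: ae_circleS eqp => z /= <-; rewrite conjcK.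
Qed.

Lemma HminusE phi : Hminus phi <->
  exists F, [/\ Hardy2_disc F, F 0 = 0 & boundary_values F (fun z => (phi z)^*)].
Proof.
split=> [[_ //]|[F [HF F0 bF]]]; split; last by exists F.
by apply: L2_circle_conj; exact: L2_boundary HF bF.
Qed.

Section Data.
Variables (A B : R[i] -> R[i]) (a b : R[i] -> R[i]).
Hypotheses (HA : Hinf_disc A) (HB : Hinf_disc B).
Hypotheses (bA : boundary_values A a) (bB : boundary_values B b).
Hypothesis B_neq0 : exists2 z, disc z & B z != 0.
Hypothesis infAB : 0 < inf [set cabs (A z) + cabs (B z) | z in @disc R].

Lemma boundary_denom_neq0 : ae_circle (fun z => b z != 0).
Proof.
have [z0 z01 Bz0] := B_neq0.
exact: boundary_neq0 (Hinf_Hardy2 HB) bB z01 Bz0.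
Qed.

Lemma corona_lower_bound : exists2 dl : R, 0 < dl &
  forall z, disc z -> dl <= cabs (A z) + cabs (B z).
Proof.
exists (inf [set cabs (A z) + cabs (B z) | z in @disc R]) => // z z1.
apply: ge_inf; last by exists z.
by exists 0 => _ [w _ <-]; rewrite addr_ge0 ?cabs_ge0.
Qed.

Lemma multiplier_boundary F f phi : Hardy2_disc F -> boundary_values F f ->
  eq_circle phi (fun z => b z * f z) ->
  [/\ Hardy2_disc (fun z => B z * F z), boundary_values (fun z => B z * F z) phi,
      Hardy2_disc (fun z => A z * F z) &
      boundary_values (fun z => A z * F z) (fun z => a z / b z * phi z)].
Proof.
move=> HF bF phiE; split; [exact: HinfM| |exact: HinfM|].
  apply: boundary_values_ext (boundary_valuesM bB bF).
  by apply: ae_circleS phiE => z ->.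
apply: boundary_values_ext (boundary_valuesM bA bF).
apply: ae_circleS (ae_circleI phiE boundary_denom_neq0) => z [-> bz].
by rewrite mulrA divfK.
Qed.

(** The quotient is [H / B] where [B] is nonzero and [G / A] elsewhere.  The
    bound [|F| <= (|H| + |G|) / dl] comes from [(|A| + |B|) |F| = |G| + |H|]. *)
Lemma coprime_division h H G : Hardy2_disc H -> boundary_values H h ->
  Hardy2_disc G -> boundary_values G (fun z => a z / b z * h z) ->
  exists F, [/\ Hardy2_disc F, boundary_values F (fun z => h z / b z) &
    forall z, disc z -> H z = B z * F z /\ G z = A z * F z].
Proof.
move=> HH bH HG bG.
have [dl dl0 Hdl] := corona_lower_bound.
(* otherwise the boundary values of [A H - B G] would be nonzero somewhere *)
have cross z : disc z -> A z * H z = B z * G z.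
  move=> z1; apply/eqP; rewrite -subr_eq0; apply/negPn/negP => nz.
  have HD : Hardy2_disc (fun z => A z * H z - B z * G z) by apply: Hardy2B; exact: HinfM.
  have bD := boundary_valuesB (boundary_valuesM bA bH) (boundary_valuesM bB bG).
  have := ae_circleI (boundary_neq0 HD bD z1 nz) boundary_denom_neq0.
  move=> /ae_circle_exists[w [/eqP nw bw]]; apply: nw.
  by field.
pose F z := if B z == 0 then G z / A z else H z / B z.
have AB0 z : disc z -> B z = 0 -> A z != 0.
  move=> z1 Bz; apply: contraTneq (Hdl z z1) => Az.
  by rewrite Az Bz cabs0 addr0 -ltNge.
have FE z : disc z -> H z = B z * F z /\ G z = A z * F z.
  move=> z1; rewrite /F; case: eqVneq => Bz.
    have Az := AB0 z z1 Bz.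
    rewrite [A z * _]mulrCA divff// mulr1 Bz mul0r; split=> //.
    by apply/eqP; rewrite -(mulrI_eq0 _ (mulfI Az)) cross// Bz mul0r.
  rewrite [B z * _]mulrCA divff// mulr1; split=> //.
  by rewrite mulrA cross// mulrAC divff// mul1r.
have [aA _] := HA; have [aB _] := HB; have [aH _] := HH; have [aG _] := HG.
have quot N D z : analytic_disc N -> analytic_disc D -> disc z -> D z != 0 ->
    (exists d, cderiv (fun w => N w / D w) z d) /\
    exists2 r : R, 0 < r & forall w, cabs (w - z) < r -> disc w /\ D w != 0.
  move=> aN aD z1 Dz; split.
    apply: derivable_cderiv.
    apply: (@derivableM R[i] R[i]^o N (fun w => (D w)^-1)); first exact: aN.
    by apply: (@derivableV R[i] R[i]^o D); [exact: Dz|exact: aD].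
  have [d /cderiv_ccont cD] := analytic_cderiv aD z1.
  have Dz2 : 0 < cabs (D z) / 2 by rewrite divr_gt0 ?cabs_gt0.
  have [r r0 Hr] := cD _ Dz2.
  have z1' : 0 < 1 - cabs z by rewrite subr_gt0.
  exists (Num.min r (1 - cabs z)); first by rewrite lt_min r0.
  move=> w; rewrite lt_min => /andP[w1 w2]; split.
    by change (cabs w < 1); have := lerB_cabs w z; lra.
  apply: contraTneq (Hr _ w1) => ->; rewrite sub0r cabsN -ltNge.
  by rewrite ltr_pdivrMr// ltr_pMr ?ltr1n// cabs_gt0.
have aF : analytic_disc F.
  apply: analytic_disc_local => z z1; have [Bz|Bz] := eqVneq (B z) 0.
    have Az := AB0 z z1 Bz.
    have [dQ [r r0 Hr]] := quot G A z aG aA z1 Az.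
    exists (fun w => G w / A w); split; [exact: dQ|by rewrite /F Bz eqxx|exists r => //].
    move=> w /Hr[w1 Aw]; have [_ ->] := FE w w1.
    by rewrite mulrAC divff// mul1r.
  have [dQ [r r0 Hr]] := quot H B z aH aB z1 Bz.
  exists (fun w => H w / B w); split; [exact: dQ|by rewrite /F (negbTE Bz)|exists r => //].
  by move=> w /Hr[w1 Bw]; rewrite /F (negbTE Bw).
exists F; split; [|  |exact: FE].
  apply: (Hardy2_dominated aF HH HG (C := dl^-1)) => z z1.
  have [-> ->] := FE z z1; rewrite !cabsM -mulrDl (addrC (cabs (B z))).
  rewrite mulrA ler_peMl ?cabs_ge0//.
  by rewrite -ler_pdivrMl ?invr_gt0// invrK mulr1; exact: Hdl.
apply: boundary_values_div bB bH boundary_denom_neq0 _ => z /FE[].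
by [].
Qed.

End Data.

End Coprime.

(* [A], [B] are the functions on the disc and [a], [b] their boundary functions;
   in the second part [A], [B] are the analytic functions on the disc with
   boundary functions the conjugates of [a], [b]. *)
Theorem proposition4p11 (R : realType) :
  (forall A B a b : R[i] -> R[i],
     Hinf_disc A -> Hinf_disc B ->
     boundary_values A a -> boundary_values B b ->
     (exists2 z, disc z & B z != 0) ->
     0 < inf [set cabs (A z) + cabs (B z) | z in @disc R] ->
     mult_domain (@Hplus R) (fun z => a z / b z)
       = ker_Hankel (fun z => a z / b z) /\
     ker_Hankel (fun z => a z / b z) = mul_space b (@Hplus R)) /\
  (forall A B a b : R[i] -> R[i],
     Hinf_disc A -> Hinf_disc B ->
     boundary_values A (fun z => (a z)^*) ->
     boundary_values B (fun z => (b z)^*) ->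
     (exists2 z, disc z & B z != 0) ->
     0 < inf [set cabs (A z) + cabs (B z) | z in @disc R] ->
     mult_domain (@Hminus R) (fun z => a z / b z)
       = ker_coHankel (fun z => a z / b z) /\
     ker_coHankel (fun z => a z / b z) = mul_space b (@Hminus R)).
Proof.
split=> A B a b HA HB bA bB B0 infAB; (split; first by []).
  apply/seteqP; split=> [phi [/HplusE[H HH bH] /HplusE[G HG bG]]|phi [f /HplusE[F HF bF] phiE]].
    have [F [HF bF _]] := coprime_division HA HB bA bB B0 infAB HH bH HG bG.
    exists (fun z => phi z / b z); first by apply/HplusE; exists F.
    apply: ae_circleS (boundary_denom_neq0 HB bB B0) => z bz.
    by rewrite mulrCA divff// mulr1.
  have [HBF bBF HAF bAF] := multiplier_boundary HA HB bA bB B0 HF bF phiE.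
  by split; apply/HplusE; [exists (fun z => B z * F z)|exists (fun z => A z * F z)].
have conj_quot phi : (fun z => (a z / b z * phi z)^*) =
    (fun z => conjc (a z) / conjc (b z) * conjc (phi z)).
  by apply/funext => z; rewrite !conjcM conjc_inv.
have b0 := boundary_denom_neq0 HB bB B0.
apply/seteqP; split=> [phi [/HminusE[H [HH H0 bH]] /HminusE[G [HG G0]]]|
    phi [f /HminusE[F [HF F0 bF]] phiE]].
  rewrite conj_quot => bG.
  have [F [HF bF FE]] := coprime_division HA HB bA bB B0 infAB HH bH HG bG.
  exists (fun z => phi z / b z); last first.
    apply: ae_circleS b0 => z; rewrite conjc_eq0 => bz.
    by rewrite mulrCA divff// mulr1.
  apply/HminusE; exists F; split; [exact: HF| |].
    have d0 : disc (0 : R[i]) by change (cabs (0 : R[i]) < 1); rewrite cabs0.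
    have [dl dl0 Hdl] := corona_lower_bound infAB.
    have [BF AF] := FE 0 d0; rewrite H0 in BF; rewrite G0 in AF.
    apply/eqP; rewrite -cabs_eq0; apply: contraTT (Hdl 0 d0) => F0.
    have [|] := eqVneq (B 0) 0; last first.
      by move=> B00; move/esym/eqP: BF; rewrite mulf_eq0 (negbTE B00) /= -cabs_eq0 (negbTE F0).
    have [|] := eqVneq (A 0) 0; last first.
      by move=> A00; move/esym/eqP: AF; rewrite mulf_eq0 (negbTE A00) /= -cabs_eq0 (negbTE F0).
    by move=> -> ->; rewrite cabs0 addr0 -ltNge.
  apply: boundary_values_ext bF; apply: ae_circleT => z.
  by rewrite (conjcM _ (b z)^-1) conjc_inv.
have phiE' : eq_circle (fun z => (phi z)^*) (fun z => conjc (b z) * conjc (f z)).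
  by apply: ae_circleS phiE => z ->; exact: conjcM.
have [HBF bBF HAF bAF] := multiplier_boundary HA HB bA bB B0 HF bF phiE'.
split; apply/HminusE.
  exists (fun z => B z * F z); split; [exact: HBF| |exact: bBF].
  by rewrite F0 mulr0.
exists (fun z => A z * F z); rewrite conj_quot; split; [exact: HAF| |exact: bAF].
by rewrite F0 mulr0.
Qed.
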